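(* Let $A$ be a real $2\times2$ matrix with $(\operatorname{tr}A)^2-4\det A<0$ and $\operatorname{tr}A\neq0$, let $\eta\in\mathbb{R}^2\setminus\{0\}$, and let $\Omega=[u^-,u^+]$ with $u^-<u^+$. Consider the linear control system $\dot v=Av+u\eta$, $u\in\Omega$, on $\mathbb{R}^2$. Let $\mathcal{C}$ be the closure of the region delimited by the periodic orbit $\mathcal{O}$ (defined in the context), and let $D=\mathcal{C}$ if $\operatorname{tr}A<0$ and $D=\operatorname{int}\mathcal{C}$ if $\operatorname{tr}A>0$. Then: 1. if $\operatorname{tr}A<0$, the only control set of the system is $D$; 2. if $\operatorname{tr}A>0$, then $\operatorname{int}D$ and $\partial D$ are the only control sets of the system (both are control sets, and there is no other).
   Context: Control functions: $\mathcal{U}$ is the set of all piecewise constant functions $\mathbf{u}:\mathbb{R}\to\Omega$ (finitely many discontinuities on each bounded interval). For $v\in\mathbb{R}^2$ and $\mathbf{u}\in\mathcal{U}$, $s\in\mathbb{R}\mapsto\varphi(s,v,\mathbf{u})$ is the unique continuous, piecewise differentiable curve with $\varphi(0,v,\mathbf{u})=v$ and $\frac{d}{ds}\varphi(s,v,\mathbf{u})=A\varphi(s,v,\mathbf{u})+\mathbf{u}(s)\eta$ (away from the discontinuities of $\mathbf{u}$). For $u\in\Omega$, $\varphi(s,v,u)$ denotes the solution for the constant control $u$; explicitly, $\varphi(s,v,u)=e^{sA}(v-v(u))+v(u)$ with $v(u)=-uA^{-1}\eta$. The positive orbit of $v$ is $\mathcal{O}^+(v)=\{\varphi(s,v,\mathbf{u})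 : s\ge0,\ \mathbf{u}\in\mathcal{U}\}$. A control set of the system is a subset $D'\subset\mathbb{R}^2$ such that: (a) for every $v\in D'$ there exists $\mathbf{u}\in\mathcal{U}$ with $\varphi(s,v,\mathbf{u})\in D'$ for all $s\ge0$; (b) for every $v\in D'$, $D'\subset\overline{\mathcal{O}^+(v)}$; (c) $D'$ is maximal with respect to set inclusion among sets satisfying (a) and (b). Let $\lambda\pm i\mu$, $\mu>0$, be the eigenvalues of $A$ (so $2\lambda=\operatorname{tr}A$), and $$P^+:=\left(\frac{-u^++e^{\pi\lambda/\mu}u^-}{1-e^{\pi\lambda/\mu}}\right)A^{-1}\eta,\qquad P^-:=\left(\frac{-u^-+e^{\pi\lambda/\mu}u^+}{1-e^{\pi\lambda/\mu}}\right)A^{-1}\eta.$$ The periodic orbit $\mathcal{O}$ is the closed curve $$\mathcal{O}:=\left\{\varphi(s,P^+,u^-) : s\in\left[0,\tfrac{\pi}{\mu}\right]\right\}\cup\left\{\varphi(s,P^-,u^+) : s\in\left[0,\tfrac{\pi}{\mu}\right]\right\}.$$ The region delimited by $\mathcal{O}$ is the bounded connected component of $\mathbb{R}^2\setminus\mathcal{O}$, and $\mathcal{C}$ is its closure. *)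

(* Defs.v *)
From mathcomp Require Import all_boot all_order all_algebra.
From mathcomp Require Import complex.
From mathcomp Require Import all_classical all_reals all_analysis.

Set Implicit Arguments.
Unset Strict Implicit.
Unset Printing Implicit Defensive.

Import Order.TTheory GRing.Theory Num.Theory.
Import numFieldNormedType.Exports.

Local Open Scope classical_set_scope.
Local Open Scope ring_scope.

(** The plane is ['cV[R]_2] with its canonical (sup-norm) topology. *)

Definition discontinuities (R : realType) (u : R -> R) : set R :=
  [set s | ~ {for s, continuous u}].

Definition piecewise_constant (R : realType) (u : R -> R) : Prop :=
  (forall a b : R, finite_set (`[a, b] `&` discontinuities u)) /\
  (forall a b : R, a <= b -> `[a, b] `<=` ~` discontinuities u -> u a = u b).

Definition controls (R : realType) (um up : R) : set (R -> R) :=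
  [set u | piecewise_constant u /\ forall s, um <= u s <= up].

(** [trajectory A eta v u x] says that [x] is the curve [s |-> phi(s, v, u)].
    It is kept as a relation; for piecewise constant [u] it determines [x]. *)
Definition trajectory (R : realType) (A : 'M[R]_2) (eta v : 'cV[R]_2)
    (u : R -> R) (x : R -> 'cV[R]_2) : Prop :=
  [/\ x 0 = v, continuous x &
      forall s : R, {for s, continuous u} ->
        is_derive s 1 x (A *m x s + u s *: eta)].

Definition positive_orbit (R : realType) (A : 'M[R]_2) (eta : 'cV[R]_2)
    (um up : R) (v : 'cV[R]_2) : set 'cV[R]_2 :=
  [set w | exists (u : R -> R) (x : R -> 'cV[R]_2) (s : R),
     [/\ controls um up u, trajectory A eta v u x, 0 <= s & w = x s]].

Definition pre_control_set (R : realType) (A : 'M[R]_2) (eta : 'cV[R]_2)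
    (um up : R) (D : set 'cV[R]_2) : Prop :=
  (forall v, D v -> exists (u : R -> R) (x : R -> 'cV[R]_2),
     [/\ controls um up u, trajectory A eta v u x &
         forall s : R, 0 <= s -> D (x s)]) /\
  (forall v, D v -> D `<=` closure (positive_orbit A eta um up v)).

Definition control_set (R : realType) (A : 'M[R]_2) (eta : 'cV[R]_2)
    (um up : R) (D : set 'cV[R]_2) : Prop :=
  pre_control_set A eta um up D /\
  forall D' : set 'cV[R]_2,
    pre_control_set A eta um up D' -> D `<=` D' -> D' = D.

(** [switch_point A eta lam mu a b] is [P^+] for [(a, b) = (u^-, u^+)] and
    [P^-] for [(a, b) = (u^+, u^-)]. *)
Definition switch_point (R : realType) (A : 'M[R]_2) (eta : 'cV[R]_2)
    (lam mu a b : R) : 'cV[R]_2 :=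
  ((- b + expR (pi * lam / mu) * a) / (1 - expR (pi * lam / mu)))
    *: (invmx A *m eta).

Definition constant_control_arc (R : realType) (A : 'M[R]_2) (eta : 'cV[R]_2)
    (v : 'cV[R]_2) (a T : R) : set 'cV[R]_2 :=
  [set w | exists (x : R -> 'cV[R]_2) (s : R),
     [/\ trajectory A eta v (cst a) x, 0 <= s <= T & w = x s]].

Definition periodic_orbit (R : realType) (A : 'M[R]_2) (eta : 'cV[R]_2)
    (um up lam mu : R) : set 'cV[R]_2 :=
  constant_control_arc A eta (switch_point A eta lam mu um up) um (pi / mu) `|`
  constant_control_arc A eta (switch_point A eta lam mu up um) up (pi / mu).

Definition bounded_component (R : realType) (S : set 'cV[R]_2) :
    set (set 'cV[R]_2) :=
  [set K | bounded_set K /\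
     exists2 v, (~` S) v & K = connected_component (~` S) v].

(** Definite description: the bounded component of the complement of [S], with
    the default value [set0] if there were none. *)
Definition delimited_region (R : realType) (S : set 'cV[R]_2) : set 'cV[R]_2 :=
  xget set0 (bounded_component S).

Definition boundary (T : topologicalType) (S : set T) : set T :=
  closure S `\` interior S.

(* Main.v *)
(** In suitable complex coordinates the system is [z' = (a + ib) (z - w)] with
    control [w] in [[-1, 1]]; reversing time when [\tr A > 0], one may take
    [a < 0 < b].  The periodic orbit consists of a half turn of a logarithmic
    spiral around [-1] and of its image by [z |-> - z].  In the upper half plane
    the parameter of the family of spirals around [-1] does not increase along
    any admissible field, whatever [w], so the closed region bounded by the orbit
    is invariant.  Two trajectories with the same control approach each other
    exponentially, hence a point recurrent after arbitrarily long times lies in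
    the closed region.  Conversely, half turns with constant control act on the
    real axis by [x |-> (1 + r) w - r x]; they steer every point to [0], and [0]
    to every interior point.  This gives the stable case.  After time reversal
    every point of the interior can be steered to [0] and from there anywhere,
    the orbit is swept by a square wave control, and the complement of the
    interior is invariant, which separates the two control sets. *)

Require Import Defs.
From mathcomp Require Import all_boot all_order all_algebra.
From mathcomp Require Import complex.
From mathcomp Require Import all_classical all_reals all_analysis.
From mathcomp Require Import zify ring lra.

Import Order.TTheory GRing.Theory Num.Theory.
Import numFieldNormedType.Exports.

Local Open Scope classical_set_scope.
Local Open Scope ring_scope.

(** * Controls and trajectories *)

(** Reversing time only changes the signs of [A] and [eta], but the notion of control set is not
    symmetric under it. In the stable case an interior point is never steered onto the orbit, since
    the interior is invariant; it only comes arbitrarily near, and the closure in the definition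
    joins the two into one set. After reversal the complement of the interior is invariant and
    closed: a point of the orbit never comes near a given interior point, so no control set meets
    both.

    The delicate point of invariance is the real axis, where the spiral parameter jumps between the
    two families. Only points of the orbit can be exits, and the orbit meets the axis only at its
    two vertices. These lie beyond every admissible equilibrium [w], so the vertical velocity there
    has a strict sign and carries the trajectory at once into a half plane where the parameter is
    monotone.

    The vertices [v] and [-v] are exchanged by the half turns around [-1] and [1]: if [r] is the
    contraction factor of a half turn, then [v = (1 + r) + r * v]. *)

Lemma is_derive_cVP (R : realType) (x : R -> 'cV[R]_2) (s : R) (d : 'cV[R]_2) :
  is_derive s 1 x d <-> forall i, is_derive s 1 (fun t => x t i 0) (d i 0).
Proof.
split=> [[xd <-] i|xd].
  have /derivable_mxP/(_ i 0) xid := xd.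
  by apply: DeriveDef => //; rewrite derive_mx// mxE.
have xD : derivable x s 1.
  by apply/derivable_mxP => i j; rewrite (ord1 j); case: (xd i).
apply: DeriveDef => //; rewrite derive_mx//; apply/matrixP => i j.
by rewrite (ord1 j) mxE; case: (xd i).
Qed.

Lemma is_derive_compN (R : realType) (x : R -> 'cV[R]_2) (t s : R) (d : 'cV[R]_2) :
  is_derive (t - s) 1 x d -> is_derive s 1 (fun s => x (t - s)) (- d).
Proof.
move=> /is_derive_cVP xd; apply/is_derive_cVP => i.
have tD : is_derive s (1 : R) (fun s => t - s) (-1).
  by apply: is_derive_eq; ring.
have := @is_derive1_comp _ (fun s => x s i 0) (fun s => t - s) _ _ _ (xd i) tD.
by rewrite mulrN1 mxE.
Qed.

Lemma near_eq_continuous_at (T U : topologicalType) (f g : T -> U) (s : T) :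
  (\near s, f s = g s) -> {for s, continuous g} -> {for s, continuous f}.
Proof.
move=> fg cg; rewrite /prop_for /continuous_at (nbhs_singleton fg).
by apply: cvg_trans cg; apply: near_eq_cvg; apply: filterS fg => z ->.
Qed.

Lemma continuous_at_compN (R : realType) (u : R -> R) (t s : R) :
  {for s, continuous (fun s => u (t - s))} <-> {for t - s, continuous u}.
Proof.
have H (v : R -> R) z : {for t - z, continuous v} ->
    {for z, continuous (fun s => v (t - s))}.
  move=> cv; apply: (@continuous_comp _ _ _ (fun s => t - s) v) => //.
  by apply: continuousB; [exact: cst_continuous|].
split=> [cu|]; last exact: H.
have -> : u = (fun s => (fun s => u (t - s)) (t - s)).
  by apply/funext => z; rewrite subKr.
by apply: (H (fun s => u (t - s)) (t - s)); rewrite subKr.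
Qed.

Lemma controls_compN {R : realType} {um up : R} {u} (t : R) :
  controls um up u -> controls um up (fun s => u (t - s)).
Proof.
move=> [[uf uc] ub]; split; last by move=> s; exact: ub.
split=> a b.
  have : finite_set ((fun s => t - s) @` (`[t - b, t - a] `&` discontinuities u)).
    exact/finite_image/uf.
  apply: sub_finite_set => s [/=]; rewrite in_itv/= => /andP[as_ sb] du.
  exists (t - s); last by rewrite subKr.
  split; first by rewrite /= in_itv/= !lerD2l !lerN2 as_ sb.
  by move=> cu; apply: du; apply/continuous_at_compN.
move=> ab H; symmetry; apply: uc; first by rewrite lerD2l lerN2.
move=> s /=; rewrite in_itv/= => /andP[bs sa] du.
apply: (H (t - s)).
  by rewrite /= in_itv/=; apply/andP; split; lra.
by move=> /continuous_at_compN; rewrite subKr.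
Qed.

Lemma trajectory_compN {R : realType} {A : 'M[R]_2} {eta v u x} t :
  trajectory A eta v u x ->
  trajectory (- A) (- eta) (x t) (fun s => u (t - s)) (fun s => x (t - s)).
Proof.
move=> [x0 cx dx]; split; first by rewrite subr0.
  move=> s; apply: (@continuous_comp _ _ _ (fun s => t - s) x) => //.
    by apply: continuousB; [exact: cst_continuous|].
  exact: cx.
move=> s /continuous_at_compN/dx/is_derive_compN.
by rewrite mulNmx scalerN opprD.
Qed.

(** A time shift is the composite of two time reflections. *)
Lemma controls_shift {R : realType} {um up : R} {u} (t : R) :
  controls um up u -> controls um up (fun s => u (s - t)).
Proof.
move=> /(controls_compN (- t))/(controls_compN 0).
by congr controls; apply/funext => s; congr u; lra.
Qed.

Lemma trajectory_shift {R : realType} {A : 'M[R]_2} {eta v u x} t :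
  trajectory A eta v u x ->
  trajectory A eta (x (- t)) (fun s => u (s - t)) (fun s => x (s - t)).
Proof.
move=> /(trajectory_compN (- t))/(trajectory_compN 0).
rewrite !opprK subr0; congr trajectory.
  by apply/funext => s; congr u; lra.
by apply/funext => s; congr x; lra.
Qed.

(** Concatenated controls are made discontinuous at the junction: [trajectory]
    then says nothing about the derivative there. *)
Lemma discontinuous_at_junction (R : realType) (u1 u2 : R -> R) (um up t : R) :
  um < up -> exists2 c, um <= c <= up &
    ~ {for t, continuous (fun s => if s < t then u1 s else if s == t then c else u2 s)}.
Proof.
move=> umup.
pose f c := fun s => if s < t then u1 s else if s == t then c else u2 s.
(* The value at [t] does not influence the punctured limit there, so at most one of [um] and [up]
   makes the function continuous. *)
have [cm|cm] := pselect {for t, continuous (f um)}; last first.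
  by exists um => //; rewrite lexx ltW.
have [cp|cp] := pselect {for t, continuous (f up)}; last first.
  by exists up => //; rewrite lexx ltW.
exfalso; suff : um = up by move=> E; move: umup; rewrite E ltxx.
have fE c : f c t = c by rewrite /f ltxx eqxx.
have {}cm : f um @ t^' --> um by rewrite -[X in _ --> X](fE um);
  exact: cvg_within_filter cm.
have {}cp : f up @ t^' --> up by rewrite -[X in _ --> X](fE up);
  exact: cvg_within_filter cp.
have {}cp : f um @ t^' --> up.
  apply: cvg_trans cp; apply: near_eq_cvg.
  near=> s; rewrite /f; case: ifP => // _; case: ifPn => // /eqP st.
  by exfalso; move/eqP: st; apply/negP; near: s; exact: nbhs_dnbhs_neq.
exact: (cvg_unique _ cm cp).
Unshelve. all: by end_near. Qed.

(** The forced discontinuity at [t] serves the second clause of [piecewise_constant]: an interval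
    free of discontinuities cannot contain [t], hence lies in one of the two pieces. *)
Lemma concat_control (R : realType) (um up : R) u1 u2 (t c : R)
    (u := fun s => if s < t then u1 s else if s == t then c else u2 s) :
  controls um up u1 -> controls um up u2 -> um <= c <= up ->
  ~ {for t, continuous u} -> controls um up u.
Proof.
move=> [[u1f u1c] u1b] [[u2f u2c] u2b] cb ut.
have ul s : s < t -> \near s, u s = u1 s.
  by move=> st; near=> z; rewrite /u ifT//; near: z; exact: lt_nbhsl.
have ur s : t < s -> \near s, u s = u2 s.
  move=> st; near=> z.
  have tz : t < z by near: z; exact: lt_nbhsr.
  by rewrite /u ltNge (ltW tz)/= gt_eqF.
have dl s : s < t -> {for s, continuous u} <-> {for s, continuous u1}.
  move=> /ul H; split; apply: near_eq_continuous_at => //.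
  by apply: filterS H => z ->.
have dr s : t < s -> {for s, continuous u} <-> {for s, continuous u2}.
  move=> /ur H; split; apply: near_eq_continuous_at => //.
  by apply: filterS H => z ->.
split; last first.
  by move=> s; rewrite /u; case: ifP => // _; case: ifP.
split=> a b.
  have : finite_set ((`[a, b] `&` discontinuities u1) `|`
      (`[a, b] `&` discontinuities u2) `|` [set t]).
    by rewrite !finite_setU; do !split => //; exact: finite_set1.
  apply: sub_finite_set => s [sab du].
  case: (ltgtP s t) => [st|st|->]; last by right.
    by left; left; split => // cu; apply: du; exact/(dl _ st).
  by left; right; split => // cu; apply: du; exact/(dr _ st).
move=> ab H.
have [bt|tb] := ltP b t.
  rewrite /u (le_lt_trans ab bt) bt; apply: u1c => // s sab du; apply: (H s sab).
  have st : s < t by move: sab; rewrite /= in_itv/= => /andP[_ /le_lt_trans]; apply.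
  by move=> /(dl _ st).
have [at_|ta] := leP a t.
  by exfalso; apply: (H t) => //=; rewrite in_itv/= at_ tb.
rewrite /u !ltNge (ltW ta) tb/= (gt_eqF ta) (gt_eqF (lt_le_trans ta ab)).
apply: u2c => // s sab du; apply: (H s sab).
have st : t < s by move: sab; rewrite /= in_itv/= => /andP[/(lt_le_trans ta)].
by move=> /(dr _ st).
Unshelve. all: by end_near. Qed.

Lemma trajectory_concat {R : realType} {A : 'M[R]_2} {eta} {um up : R} {v u1 x1 u2 x2}
    {t : R} :
  um < up -> 0 <= t ->
  controls um up u1 -> trajectory A eta v u1 x1 ->
  controls um up u2 -> trajectory A eta (x1 t) u2 x2 ->
  exists2 u, controls um up u &
    trajectory A eta v u (fun s => if s < t then x1 s else x2 (s - t)).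
Proof.
move=> umup t0 cu1 [x10 cx1 dx1] cu2 tx2.
have := trajectory_shift t tx2.
set v' := x2 _; move=> [_ cx2 dx2].
have [x20 _ _] := tx2.
have cu2' := controls_shift t cu2.
have [c cb ut] := discontinuous_at_junction _ u1 (fun s => u2 (s - t)) _ _ t umup.
pose u := fun s => if s < t then u1 s else if s == t then c else u2 (s - t).
rewrite -/u in ut; exists u.
  exact: (concat_control _ _ _ _ (fun s => u2 (s - t))).
pose x := fun s => if s < t then x1 s else x2 (s - t); rewrite -/x.
have xl s : s < t -> \near s, x1 s = x s.
  by move=> st; near=> z; rewrite /x ifT//; near: z; exact: lt_nbhsl.
have xr s : t < s -> \near s, x2 (s - t) = x s.
  move=> st; near=> z.
  have tz : t < z by near: z; exact: lt_nbhsr.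
  by rewrite /x ltNge (ltW tz)/=.
have ul s : s < t -> \near s, u1 s = u s.
  by move=> st; near=> z; rewrite /u ifT//; near: z; exact: lt_nbhsl.
have ur s : t < s -> \near s, u2 (s - t) = u s.
  move=> st; near=> z.
  have tz : t < z by near: z; exact: lt_nbhsr.
  by rewrite /u ltNge (ltW tz)/= gt_eqF.
split.
- rewrite /x; case: ltP => // t0'; have -> : t = 0 by apply/le_anti/andP.
  rewrite subr0 x20; have -> : t = 0 by apply/le_anti/andP.
  by [].
- move=> s; case: (ltgtP s t) => [st|st|->].
  + apply: near_eq_continuous_at (cx1 s).
    by apply: filterS (xl _ st) => z ->.
  + apply: near_eq_continuous_at (cx2 s).
    by apply: filterS (xr _ st) => z ->.
  + have xt : x t = x1 t by rewrite /x ltxx subrr.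
    apply/cvgrPdist_lt => e e0; rewrite /= xt.
    have /cvgrPdist_lt/(_ _ e0) H1 := cx1 t.
    have := cx2 t; rewrite /continuous_at subrr x20 => /cvgrPdist_lt/(_ _ e0) H2.
    near=> z; rewrite /x; case: ifP => _; [near: z; exact: H1|near: z; exact: H2].
- move=> s; case: (ltgtP s t) => [st|st|->//] cu.
  + have := xl _ st => /near_eq_is_derive; apply.
    have xE := nbhs_singleton (xl _ st); have uE := nbhs_singleton (ul _ st).
    rewrite -xE -uE; apply: dx1; apply: near_eq_continuous_at cu.
    exact: ul.
  + have := xr _ st => /near_eq_is_derive; apply.
    have xE := nbhs_singleton (xr _ st); have uE := nbhs_singleton (ur _ st).
    rewrite -xE -uE; apply: dx2; apply: near_eq_continuous_at cu.
    exact: ur.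
Unshelve. all: by end_near. Qed.

(** * Coordinates *)

Record frame (R : realType) := Frame {
  org : 'cV[R]_2;
  ex : 'cV[R]_2;
  ey : 'cV[R]_2;
  frame_free : ex 0 0 * ey 1 0 - ex 1 0 * ey 0 0 != 0 }.
Arguments org {R}.
Arguments ex {R}.
Arguments ey {R}.

Section Coordinates.
Context {R : realType}.
Implicit Types (F : frame R) (v : 'cV[R]_2).

Definition frame_det F : R := ex F 0 0 * ey F 1 0 - ex F 1 0 * ey F 0 0.
Definition pt F (x y : R) : 'cV[R]_2 := org F + (x *: ex F + y *: ey F).
(** Cramer's rule. [lx] and [ly] are linear and read off velocities; [cx] and [cy] subtract the
    origin and read off positions. *)
Definition lx F v : R := (v 0 0 * ey F 1 0 - v 1 0 * ey F 0 0) / frame_det F.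
Definition ly F v : R := (ex F 0 0 * v 1 0 - ex F 1 0 * v 0 0) / frame_det F.
Definition cx F v : R := lx F (v - org F).
Definition cy F v : R := ly F (v - org F).

Lemma cV2P (v w : 'cV[R]_2) : v 0 0 = w 0 0 -> v 1 0 = w 1 0 -> v = w.
Proof.
move=> E0 E1; apply/matrixP => i j; rewrite (ord1 j).
case: i => -[|[|//]] ilt; first by rewrite (_ : Ordinal _ = 0)//; exact: val_inj.
by rewrite (_ : Ordinal _ = 1)//; exact: val_inj.
Qed.

Lemma ptK1 F x y : cx F (pt F x y) = x.
Proof.
rewrite /cx /lx /pt /frame_det !mxE; field; exact: frame_free.
Qed.

Lemma ptK2 F x y : cy F (pt F x y) = y.
Proof.
rewrite /cy /ly /pt /frame_det !mxE; field; exact: frame_free.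
Qed.

Lemma ptK F v : pt F (cx F v) (cy F v) = v.
Proof.
apply: cV2P; rewrite /pt /cx /cy /lx /ly /frame_det !mxE; field;
  exact: frame_free.
Qed.

Lemma continuous_coord_comb (o : 'cV[R]_2) (k0 k1 : R) :
  continuous (fun w : 'cV[R]_2 => (w 0 0 - o 0 0) * k0 + (w 1 0 - o 1 0) * k1).
Proof.
have H (v : 'cV[R]_2) i k : {for v, continuous (fun w : 'cV[R]_2 =>
  (w i 0 - o i 0) * k)}.
  apply: continuousM; last exact: cst_continuous.
  apply: continuousB; last exact: cst_continuous.
  exact: coord_continuous.
have Hd (v : 'cV[R]_2) : {for v, continuous (fun w : 'cV[R]_2 =>
  (w 0 0 - o 0 0) * k0 + (w 1 0 - o 1 0) * k1)}.
  by apply: continuousD; exact: H.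
exact: Hd.
Qed.

Lemma cx_continuous F : continuous (cx F).
Proof.
rewrite (_ : cx F = fun w => (w 0 0 - org F 0 0) * (ey F 1 0 / frame_det F) +
    (w 1 0 - org F 1 0) * (- ey F 0 0 / frame_det F)).
  exact: continuous_coord_comb.
by apply/funext => w; rewrite /cx /lx !mxE; ring.
Qed.

Lemma cy_continuous F : continuous (cy F).
Proof.
rewrite (_ : cy F = fun w => (w 0 0 - org F 0 0) * (- ex F 1 0 / frame_det F) +
    (w 1 0 - org F 1 0) * (ex F 0 0 / frame_det F)).
  exact: continuous_coord_comb.
by apply/funext => w; rewrite /cy /ly !mxE; ring.
Qed.

Lemma pt_continuous (T : topologicalType) F (f g : T -> R) (t : T) :
  {for t, continuous f} -> {for t, continuous g} ->
  {for t, continuous (fun s => pt F (f s) (g s))}.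
Proof.
move=> cf cg; rewrite /pt; apply: cvgD; first exact: cvg_cst.
by apply: cvgD; apply: cvgZr_tmp.
Qed.

(** [w] is the position of the equilibrium of this control on the real axis of an adapted frame. The
    order is reversed: [w = -1] is [up] and [w = 1] is [um]. *)
Definition ctrl (um up w : R) : R := (up + um) / 2 - (up - um) / 2 * w.

(** In the coordinates [z = x + iy] of an adapted frame the system with the
    control [ctrl um up w], [w] in [-1, 1], reads [z' = (a + ib) (z - w)]. *)
Definition adapted F (A : 'M[R]_2) (eta : 'cV[R]_2) (um up a b : R) : Prop :=
  [/\ A *m org F = - ((up + um) / 2) *: eta,
      A *m ex F = ((up - um) / 2) *: eta,
      A *m ex F = a *: ex F + b *: ey F &
      A *m ey F = - b *: ex F + a *: ey F].

Lemma ctrl_surj um up u : um < up -> um <= u <= up ->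
  exists2 w, -1 <= w <= 1 & u = ctrl um up w.
Proof.
move=> umup /andP[u1 u2]; have h : 0 < (up - um) / 2 by lra.
exists (((up + um) / 2 - u) / ((up - um) / 2)).
  by rewrite ler_pdivrMr// ler_pdivlMr//; apply/andP; split; lra.
by rewrite /ctrl; field; rewrite subr_eq0 gt_eqF.
Qed.

Lemma ctrl_bound um up w : um < up -> -1 <= w <= 1 -> um <= ctrl um up w <= up.
Proof. by move=> umup /andP[w1 w2]; rewrite /ctrl; apply/andP; split; nra. Qed.

Lemma controls_cst um up w : um < up -> -1 <= w <= 1 ->
  controls um up (cst (ctrl um up w)).
Proof.
move=> umup wb; split; last by move=> s; exact: ctrl_bound.
split=> // a b; rewrite (_ : _ `&` _ = set0)//.
by rewrite -subset0 => s [_ /=]; apply; exact: cst_continuous.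
Qed.

(** [rotx] and [roty] are the real and imaginary parts of [exp ((a + ib) s) (x + iy)]. *)
Definition rotx (a b s x y : R) : R :=
    expR (a * s) * (cos (b * s) * x - sin (b * s) * y).
Definition roty (a b s x y : R) : R :=
    expR (a * s) * (sin (b * s) * x + cos (b * s) * y).

Lemma is_derive_rotx (a b s x y : R) :
  is_derive s 1 (fun s => rotx a b s x y)
    (a * rotx a b s x y - b * roty a b s x y).
Proof.
rewrite /rotx /roty; apply: is_derive_eq.
rewrite /GRing.scale /=; ring.
Qed.

Lemma is_derive_roty (a b s x y : R) :
  is_derive s 1 (fun s => roty a b s x y)
    (b * rotx a b s x y + a * roty a b s x y).
Proof.
rewrite /rotx /roty; apply: is_derive_eq.
rewrite /GRing.scale /=; ring.
Qed.

Lemma rot_norm a b s x y :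
  rotx a b s x y ^+ 2 + roty a b s x y ^+ 2 = expR (a * s) ^+ 2 * (x ^+ 2 + y ^+ 2).
Proof.
have E := cos2Dsin2 (b * s); rewrite /rotx /roty.
transitivity (expR (a * s) ^+ 2 * ((cos (b * s) ^+ 2 +
  sin (b * s) ^+ 2) * (x ^+ 2 + y ^+ 2))).
  by ring.
by rewrite E mul1r.
Qed.

Lemma rot0 a b x y : rotx a b 0 x y = x /\ roty a b 0 x y = y.
Proof. by rewrite /rotx /roty !mulr0 expR0 cos0 sin0; split; ring. Qed.

Lemma is_derive_pt F (f g : R -> R) (s df dg : R) :
  is_derive s 1 f df -> is_derive s 1 g dg ->
  is_derive s 1 (fun t => pt F (f t) (g t)) (df *: ex F + dg *: ey F).
Proof.
move=> fD gD; apply/is_derive_cVP => i; rewrite /pt.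
under eq_fun do rewrite !mxE.
rewrite !mxE; apply: is_derive_eq; rewrite /GRing.scale /=; ring.
Qed.

Lemma is_derive_cx F (x : R -> 'cV[R]_2) (s : R) d : is_derive s 1 x d ->
    is_derive s 1 (cx F \o x) (lx F d).
Proof.
move=> /is_derive_cVP xd; have x0 := xd 0; have x1 := xd 1.
rewrite /comp /cx /lx; under eq_fun do rewrite !mxE.
apply: is_derive_eq; rewrite /GRing.scale /=; ring.
Qed.

Lemma is_derive_cy F (x : R -> 'cV[R]_2) (s : R) d : is_derive s 1 x d ->
    is_derive s 1 (cy F \o x) (ly F d).
Proof.
move=> /is_derive_cVP xd; have x0 := xd 0; have x1 := xd 1.
rewrite /comp /cy /ly; under eq_fun do rewrite !mxE.
apply: is_derive_eq; rewrite /GRing.scale /=; ring.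
Qed.

Section Adapted.
Context {F : frame R} {A : 'M[R]_2} {eta : 'cV[R]_2} {um up a b : R}.
Hypotheses (umup : um < up) (FA : adapted F A eta um up a b).

Lemma field_pt x y w : A *m pt F x y + ctrl um up w *: eta =
  (a * (x - w) - b * y) *: ex F + (b * (x - w) + a * y) *: ey F.
Proof.
have [Ao Aeta Aex Aey] := FA.
have -> : (a * (x - w) - b * y) *: ex F + (b * (x - w) + a * y) *: ey F =
    (x - w) *: (A *m ex F) + y *: (A *m ey F).
  by rewrite Aex Aey; apply: cV2P; rewrite !mxE; ring.
rewrite /pt /ctrl !mulmxDr -!scalemxAr Ao Aeta.
by move: (A *m ey F) => e; apply: cV2P; rewrite !mxE; ring.
Qed.

Lemma lxE x y : lx F (x *: ex F + y *: ey F) = x.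
Proof. rewrite /lx /frame_det !mxE; field; exact: frame_free. Qed.

Lemma lyE x y : ly F (x *: ex F + y *: ey F) = y.
Proof. rewrite /ly /frame_det !mxE; field; exact: frame_free. Qed.

Lemma is_derive_coords (x : R -> 'cV[R]_2) (s w : R) :
  is_derive s 1 x (A *m x s + ctrl um up w *: eta) ->
  is_derive s 1 (cx F \o x) (a * (cx F (x s) - w) - b * cy F (x s)) /\
  is_derive s 1 (cy F \o x) (b * (cx F (x s) - w) + a * cy F (x s)).
Proof.
rewrite -[in A *m _](ptK F (x s)) field_pt => xD.
by split; [have := is_derive_cx F _ _ _ xD; rewrite lxE|
           have := is_derive_cy F _ _ _ xD; rewrite lyE].
Qed.

Lemma trajectory_rot x y w :
  trajectory A eta (pt F x y) (cst (ctrl um up w))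
    (fun s => pt F (w + rotx a b s (x - w) y) (roty a b s (x - w) y)).
Proof.
have D (s : R) : is_derive s 1
    (fun s => pt F (w + rotx a b s (x - w) y) (roty a b s (x - w) y))
    (A *m pt F (w + rotx a b s (x - w) y) (roty a b s (x - w) y) + ctrl um up w *: eta).
  rewrite field_pt; apply: is_derive_pt.
    have xD := is_derive_rotx a b s (x - w) y.
    have wD : is_derive s (1 : R) (fun _ : R => w) 0 by exact: is_derive_cst.
    by have := is_deriveD wD xD; rewrite add0r [w + _]addrC addrK.
  by rewrite [w + _]addrC addrK; exact: is_derive_roty.
split=> //.
- by have [-> ->] := rot0 a b (x - w) y; rewrite addrC subrK.
- move=> s; apply/differentiable_continuous/derivable1_diffP.
  by case: (D s).
Qed.

(** By linearity the difference of two trajectories with the same control solves the homogeneous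
    equation. This gives both the contraction estimate and the openness of the flow. *)
Lemma trajectory_translate v u x p q : trajectory A eta v u x ->
  trajectory A eta (pt F (cx F v + p) (cy F v + q)) u
    (fun s => pt F (cx F (x s) + rotx a b s p q) (cy F (x s) + roty a b s p q)).
Proof.
have [Ao Aeta Aex Aey] := FA.
move=> [x0 cx0 dx].
have E : (fun s => pt F (cx F (x s) + rotx a b s p q) (cy F (x s) + roty a b s p q)) =
    (fun s => x s + (pt F (rotx a b s p q) (roty a b s p q) - org F)).
  apply/funext => s; rewrite -{3}(ptK F (x s)) /pt.
  by apply: cV2P; rewrite !mxE; ring.
have D (s : R) : is_derive s 1 (fun s => pt F (rotx a b s p q) (roty a b s p q))
   ((a * rotx a b s p q - b * roty a b s p q) *: ex F +
    (b * rotx a b s p q + a * roty a b s p q) *: ey F).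
  by apply: is_derive_pt; [exact: is_derive_rotx|exact: is_derive_roty].
have cD : continuous (fun s : R => pt F (rotx a b s p q) (roty a b s p q)).
  by move=> s; apply/differentiable_continuous/derivable1_diffP; case: (D s).
split.
- by have [-> ->] := rot0 a b p q; rewrite x0.
- rewrite E => s; apply: cvgD; first exact: cx0.
  by apply: cvgB; [exact: cD|exact: cvg_cst].
- move=> s /dx xs; rewrite (congr1 (fun f => f s) E) E; apply: is_derive_eq.
  rewrite subr0 mulmxDr; set r1 := rotx _ _ _ _ _; set r2 := roty _ _ _ _ _.
  rewrite (_ : pt F r1 r2 - org F = r1 *: ex F + r2 *: ey F); last first.
    by rewrite /pt addrC addKr.
  rewrite mulmxDr -!scalemxAr Aex Aey; move: (A *m x s) => e.
  by apply: cV2P; rewrite !mxE; ring.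
Qed.

(** The squared distance of the two solutions, multiplied by [exp (- 2 a s)], has derivative zero
    and vanishes at time 0. *)
Lemma trajectory_cst_unique v w x x' :
  trajectory A eta v (cst (ctrl um up w)) x ->
  trajectory A eta v (cst (ctrl um up w)) x' -> x = x'.
Proof.
move=> [x0 _ xD] [x0' _ xD'].
have D (s : R) : is_derive s 1 x (A *m x s + ctrl um up w *: eta).
  by apply: xD; exact: cst_continuous.
have D' (s : R) : is_derive s 1 x' (A *m x' s + ctrl um up w *: eta).
  by apply: xD'; exact: cst_continuous.
pose X s := (cx F \o x) s - (cx F \o x') s; pose Y s := (cy F \o x) s - (cy F \o x') s.
pose g s := expR (- a * s) ^+ 2 * (X s ^+ 2 + Y s ^+ 2).
have gD (s : R) : is_derive s (1 : R) g 0.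
  have [d1 d2] := is_derive_coords _ _ _ (D s).
  have [d1' d2'] := is_derive_coords _ _ _ (D' s).
  rewrite /g /X /Y; apply: is_derive_eq.
  rewrite /GRing.scale /= /comp; ring.
apply/funext => s.
have : g s = 0.
  by rewrite (@is_derive_0_is_cst R g s 0 gD) /g /X /Y /= x0 x0' !subrr expr0n/=
    addr0 mulr0.
move=> /eqP; rewrite mulf_eq0 expf_eq0/= gt_eqF ?expR_gt0//=.
rewrite paddr_eq0 ?sqr_ge0// !sqrf_eq0 !subr_eq0 => /andP[/eqP /= Ex /eqP /= Ey].
by rewrite -(ptK F (x s)) -(ptK F (x' s)) Ex Ey.
Qed.

End Adapted.
End Coordinates.

(** * Eigenvalues and the adapted frame *)

Lemma det2E (R : comNzRingType) (A : 'M[R]_2) : \det A = A 0 0 * A 1 1 - A 0 1 * A 1 0.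
Proof.
rewrite (expand_det_row _ ord0) !big_ord_recl big_ord0 /cofactor !det_mx11 !mxE /=.
rewrite expr0 expr1 mul1r mulN1r addr0 mulrN.
by congr (A _ _ * A _ _ - A _ _ * A _ _); apply/val_inj.
Qed.

Lemma tr2E (R : nzRingType) (A : 'M[R]_2) : \tr A = A 0 0 + A 1 1.
Proof.
rewrite /mxtrace !big_ord_recl big_ord0 addr0; congr (A _ _ + A _ _); exact/val_inj.
Qed.

Lemma mul2E (R : nzRingType) (A : 'M[R]_2) (v : 'cV[R]_2) i :
  (A *m v) i 0 = A i 0 * v 0 0 + A i 1 * v 1 0.
Proof.
rewrite mxE !big_ord_recl big_ord0 addr0.
by congr (A _ _ * v _ _ + A _ _ * v _ _); apply/val_inj.
Qed.

(** The characteristic polynomial vanishes at the complex eigenvalue. Its imaginary part, divided by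
    [mu], gives the trace, and its real part then gives the determinant. *)
Lemma eigenvalue_tr_det (R : realType) (A : 'M[R]_2) (lam mu : R) : mu != 0 ->
  eigenvalue (map_mx (real_complex R) A) (lam +i* mu)%C ->
  \tr A = 2 * lam /\ \det A = lam ^+ 2 + mu ^+ 2.
Proof.
move=> mu0 /eigenvalueP[v vE vn0].
set a := (lam +i* mu)%C in vE.
pose c i j := real_complex R (A i j).
have E j : v 0 0 * c 0 j + v 0 1 * c 1 j = a * v 0 j.
  have := congr1 (fun w : 'rV_2 => w 0 j) vE;
    rewrite !mxE !big_ord_recl big_ord0 addr0 !mxE => <-.
  by congr (v _ _ * real_complex R (A _ _) + v _ _ * real_complex R (A _ _));
    apply/val_inj.
have E0 := E 0; have E1 := E 1.
have K : (c 0 0 - a) * (c 1 1 - a) - c 0 1 * c 1 0 = 0.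
  set K := (X in X = 0).
  have K0 : K * v 0 0 = 0.
    transitivity ((c 1 1 - a) * (v 0 0 * c 0 0 + v 0 1 * c 1 0 - a * v 0 0) -
      c 1 0 * (v 0 0 * c 0 1 + v 0 1 * c 1 1 - a * v 0 1)); first by rewrite /K; ring.
    by rewrite E0 E1 !subrr !mulr0 subrr.
  have K1 : K * v 0 1 = 0.
    transitivity ((c 0 0 - a) * (v 0 0 * c 0 1 + v 0 1 * c 1 1 - a * v 0 1) -
      c 0 1 * (v 0 0 * c 0 0 + v 0 1 * c 1 0 - a * v 0 0)); first by rewrite /K; ring.
    by rewrite E0 E1 !subrr !mulr0 subrr.
  apply/eqP; apply: contraNT vn0 => Kn0.
  move/eqP: K0; rewrite mulf_eq0 (negPf Kn0)/= => /eqP v0.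
  move/eqP: K1; rewrite mulf_eq0 (negPf Kn0)/= => /eqP v1.
  apply/eqP/rowP => j; rewrite mxE; case: j => -[|[|//]] jlt.
    by rewrite -v0; congr (v _ _); exact/val_inj.
  by rewrite -v1; congr (v _ _); exact/val_inj.
move: K; rewrite /c /a => /eqP; rewrite eq_complex /= => /andP[/eqP K1 /eqP K2].
rewrite tr2E det2E.
have T : A 0 0 + A 1 1 = 2 * lam.
  by apply: (mulfI mu0); move: K2; rewrite ?mul0r ?mulr0 => K2; lra.
by split=> //; move: K1; rewrite ?mul0r ?mulr0 => K1; nra.
Qed.

(** The third equation of [adapted] forces [ey]; the fourth then follows from Cayley-Hamilton. *)
Lemma exists_frame (R : realType) (A : 'M[R]_2) (eta q : 'cV[R]_2) (um up a b : R) :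
  \tr A = 2 * a -> \det A = a ^+ 2 + b ^+ 2 -> 0 < b -> A *m q = eta -> eta != 0 ->
    um < up ->
  exists F, [/\ adapted F A eta um up a b, org F = - ((up + um) / 2) *: q &
    ex F = ((up - um) / 2) *: q].
Proof.
move=> trE detE b0 Aq eta0 umup; set m := (up - um) / 2.
have m0 : 0 < m by rewrite /m; lra.
have bn : b != 0 by rewrite gt_eqF.
pose f1 := m *: q; pose f2 := b^-1 *: (A *m f1 - a *: f1).
rewrite tr2E det2E in trE detE.
have qn0 : q != 0 by apply: contraNneq eta0 => q0; rewrite -Aq q0 mulmx0.
(* The determinant is a nonzero multiple of a quadratic form in [q] of discriminant [- 4 b ^ 2]; a
   zero [q] of it would be a real eigenvector of [A]. *)
have free : f1 0 0 * f2 1 0 - f1 1 0 * f2 0 0 != 0.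
  have -> : f1 0 0 * f2 1 0 - f1 1 0 * f2 0 0 =
      m ^+ 2 / b * (A 1 0 * q 0 0 ^+ 2 +
        (A 1 1 - A 0 0) * q 0 0 * q 1 0 - A 0 1 * q 1 0 ^+ 2).
    rewrite /f2 -scalemxAr; have e0 := mul2E _ A q 0; have e1 := mul2E _ A q 1.
    rewrite /f1; move: (A *m q) e0 e1 => w e0 e1; rewrite !mxE e0 e1; field.
    exact: bn.
  apply: mulf_neq0; first exact: mulf_neq0 (expf_neq0 _ (lt0r_neq0 m0)) (invr_neq0 bn).
  apply/eqP => K.
  (* Completing the square in the form, after multiplication by [4 * A 1 0]. *)
  have S : (2 * A 1 0 * q 0 0 + (A 1 1 - A 0 0) * q 1 0) ^+ 2 +
    (2 * b * q 1 0) ^+ 2 = 0.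
    transitivity (4 * A 1 0 * (A 1 0 * q 0 0 ^+ 2 +
      (A 1 1 - A 0 0) * q 0 0 * q 1 0 - A 0 1 * q 1 0 ^+ 2)).
      have -> : (2 * b * q 1 0) ^+ 2 = 4 * b ^+ 2 * q 1 0 ^+ 2 by ring.
      have -> : b ^+ 2 = A 0 0 * A 1 1 - A 0 1 * A 1 0 - ((A 0 0 + A 1 1) / 2) ^+ 2.
        by rewrite trE detE; field.
      by field.
    by rewrite K mulr0.
  move/eqP: S; rewrite paddr_eq0 ?sqr_ge0// !sqrf_eq0 => /andP[S1].
  rewrite !mulf_eq0 (negPf bn) pnatr_eq0/= => /eqP q1.
  move: S1; rewrite q1 mulr0 addr0 !mulf_eq0 pnatr_eq0/= => /orP[/eqP A10|/eqP q0].
    have : 0 < b ^+ 2 by rewrite exprn_gt0.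
    have -> : b ^+ 2 = - ((A 1 1 - A 0 0) / 2) ^+ 2.
      transitivity (A 0 0 * A 1 1 - A 0 1 * A 1 0 - ((A 0 0 + A 1 1) / 2) ^+ 2).
        by rewrite trE detE; field.
      by rewrite A10; field.
    by rewrite oppr_gt0 ltNge sqr_ge0.
  by move/eqP: qn0; apply; apply: cV2P; rewrite mxE.
exists (Frame _ (- ((up + um) / 2) *: q) f1 f2 free); split=> //; split=> /=.
- by rewrite -scalemxAr Aq.
- by rewrite /f1 -scalemxAr Aq.
- by rewrite /f2 [b *: (_ *: _)]scalerA mulfV// scale1r addrC subrK.
- have CH (v : 'cV[R]_2) : A *m (A *m v) = 2 * a *: (A *m v) - (a ^+ 2 + b ^+ 2) *: v.
    have e0 := mul2E _ A v 0; have e1 := mul2E _ A v 1.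
    have d0 := mul2E _ A (A *m v) 0; have d1 := mul2E _ A (A *m v) 1.
    rewrite -trE -detE; move: (A *m v) (A *m (A *m v)) e0 e1 d0 d1 => w z e0 e1 d0 d1.
    by apply: cV2P; rewrite !mxE ?d0 ?d1 e0 e1; ring.
  rewrite {1}/f2 -scalemxAr mulmxBr CH -[A *m (a *: f1)]scalemxAr.
  rewrite /f2; move: (A *m f1) => w; apply: cV2P; rewrite !mxE; field; exact: bn.
Qed.

(** * The two families of logarithmic spirals *)

Section Spiral.
Context {R : realType}.
Variable k : R.
Hypothesis k0 : 0 < k.

(** Factor by which a half turn shrinks the distance to its center. *)
Definition decay : R := expR (- k * pi).
(** With this factor the spiral [t = 1] joins [vertex] to [- vertex]. *)
Definition spiral_scale : R := 2 / (1 - decay).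
(** Positive end of the orbit on the real axis, the solution of
    [- (1 + decay) - decay * x = - x]. *)
Definition vertex : R := (1 + decay) / (1 - decay).
Definition sradius (t th : R) : R := t * spiral_scale * expR (- k * th).
Definition sx (t th : R) : R := -1 + sradius t th * cos th.
Definition sy (t th : R) : R := sradius t th * sin th.

Lemma decay_gt0 : 0 < decay. Proof. exact: expR_gt0. Qed.

Lemma decay_lt1 : decay < 1.
Proof. by rewrite /decay expR_lt1 mulNr oppr_lt0 mulr_gt0 ?pi_gt0. Qed.

Lemma spiral_scale_gt0 : 0 < spiral_scale.
Proof. by rewrite divr_gt0// subr_gt0 decay_lt1. Qed.

Lemma spiral_scaleE : spiral_scale = vertex + 1.
Proof.
rewrite /spiral_scale /vertex; field; rewrite subr_eq0 eq_sym lt_eqF//;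
  exact: decay_lt1.
Qed.

Lemma spiral_scale_decay : spiral_scale * decay = vertex - 1.
Proof.
rewrite /spiral_scale /vertex; field; rewrite subr_eq0 eq_sym lt_eqF//;
  exact: decay_lt1.
Qed.

Lemma vertex_gt1 : 1 < vertex.
Proof. by rewrite -subr_gt0 -spiral_scale_decay mulr_gt0 ?spiral_scale_gt0
  ?decay_gt0. Qed.

Lemma vertexE : decay * vertex = vertex - (1 + decay).
Proof.
rewrite /vertex; field; rewrite subr_eq0 eq_sym lt_eqF//; exact: decay_lt1.
Qed.

Lemma sradius_ge0 t th : 0 <= t -> 0 <= sradius t th.
Proof. by move=> t0; exact: mulr_ge0 (mulr_ge0 t0 (ltW spiral_scale_gt0)) (expR_ge0
  _). Qed.

Lemma sradius_gt0 t th : 0 < t -> 0 < sradius t th.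
Proof. by move=> t0; exact: mulr_gt0 (mulr_gt0 t0 spiral_scale_gt0) (expR_gt0 _). Qed.

Lemma sy_ge0 t th : 0 <= t -> 0 <= th <= pi -> 0 <= sy t th.
Proof. by move=> t0 hth; rewrite mulr_ge0 ?sradius_ge0 ?sin_ge0_pi. Qed.

Lemma sx0 t : sx t 0 = -1 + t * spiral_scale.
Proof. by rewrite /sx /sradius mulr0 expR0 cos0 !mulr1. Qed.

Lemma sxpi t : sx t pi = -1 - t * (vertex - 1).
Proof. rewrite /sx /sradius cospi -spiral_scale_decay /decay; ring. Qed.

Lemma sy0 t : sy t 0 = 0. Proof. by rewrite /sy sin0 mulr0. Qed.
Lemma sypi t : sy t pi = 0. Proof. by rewrite /sy sinpi mulr0. Qed.

(** On the real axis the upper and the lower spirals give different values of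
    [t] to a point, but these lie on the same side of [1]. *)
Lemma real_axis_level t th : 0 <= t -> 0 <= th <= pi -> sy t th = 0 ->
  ((t < 1) = (`|sx t th| < vertex)) * ((t <= 1) = (`|sx t th| <= vertex)).
Proof.
move=> t0 /andP[th0 thpi] /eqP; rewrite mulf_eq0 => s0.
have v1 := vertex_gt1.
have [t00|tn0] := eqVneq t 0.
  rewrite t00 /sx /sradius !mul0r addr0 normrN1 v1 (ltW v1); split; lra.
have tp : 0 < t by rewrite lt_neqAle eq_sym tn0.
have [->|thn0] := eqVneq th 0.
  rewrite sx0 spiral_scaleE ltr_norml ler_norml; split; apply/idP/idP.
  - by move=> ?; apply/andP; split; nra.
  - by move=> /andP[_ ?]; nra.
  - by move=> ?; apply/andP; split; nra.
  - by move=> /andP[_ ?]; nra.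
have [->|thnpi] := eqVneq th pi.
  rewrite sxpi ltr_norml ler_norml; split; apply/idP/idP.
  - by move=> ?; apply/andP; split; nra.
  - by move=> /andP[? _]; nra.
  - by move=> ?; apply/andP; split; nra.
  - by move=> /andP[? _]; nra.
have : 0 < sin th.
  by apply: sin_gt0_pi; rewrite !lt_neqAle th0 thpi thnpi eq_sym thn0.
by move: s0; rewrite (gt_eqF (sradius_gt0 t th tp))/= => /eqP ->; rewrite ltxx.
Qed.

(** Up to an additive constant this is [ln t] on the spiral of parameter [t]: in the open upper half
    plane the polar angle around [-1] is [pi / 2 - atan ((x + 1) / y)]. *)
Definition level (x y : R) : R :=
    ln ((x + 1) ^+ 2 + y ^+ 2) / 2 - k * atan ((x + 1) / y).

Lemma level_spiral t th : 0 <= t -> 0 <= th <= pi -> 0 < sy t th ->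
  0 < t /\ level (sx t th) (sy t th) = ln t + ln spiral_scale - k * (pi / 2).
Proof.
move=> t0 /andP[th0 thpi] sp.
have tn0 : t != 0.
  by apply/eqP => t00; move: sp; rewrite /sy /sradius t00 !mul0r ltxx.
have tp : 0 < t by rewrite lt_neqAle eq_sym tn0.
have thn0 : th != 0 by apply/eqP => E; move: sp; rewrite E sy0 ltxx.
have thnpi : th != pi by apply/eqP => E; move: sp; rewrite E sypi ltxx.
have thp : 0 < th by rewrite lt_neqAle eq_sym thn0.
have thlpi : th < pi by rewrite lt_neqAle thnpi.
have sinp : 0 < sin th by apply: sin_gt0_pi; rewrite thp.
have rp := sradius_gt0 t th tp.
split=> //; rewrite /level.
have -> : (sx t th + 1) ^+ 2 + sy t th ^+ 2 = sradius t th ^+ 2.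
  transitivity (sradius t th ^+ 2 * (cos th ^+ 2 + sin th ^+ 2)).
    by rewrite /sx /sy; ring.
  by rewrite cos2Dsin2 mulr1.
have -> : (sx t th + 1) / sy t th = tan (pi / 2 - th).
  rewrite /tan sinB cosB sin_pihalf cos_pihalf /sx /sy.
  by field; rewrite !gt_eqF.
rewrite tanK; last by rewrite in_itv/=; apply/andP; split; lra.
have lnE : ln (sradius t th) = ln t + ln spiral_scale - k * th.
  have rp' := spiral_scale_gt0; have tr := mulr_gt0 tp rp'.
  by rewrite /sradius lnM ?posrE ?expR_gt0// lnM ?posrE// expRK mulNr.
have -> : ln (sradius t th ^+ 2) = (ln t + ln spiral_scale - k * th) * 2.
  by rewrite lnXn// lnE mulr_natr.
by lra.
Qed.

Lemma level_spiral_inj t th t' th' : 0 <= t -> 0 <= th <= pi -> 0 <= t' ->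
    0 <= th' <= pi ->
  0 < sy t th -> sx t th = sx t' th' -> sy t th = sy t' th' -> t = t'.
Proof.
move=> t0 hth t0' hth' sp Ex Ey; have sp' : 0 < sy t' th' by rewrite -Ey.
have [tp E] := level_spiral _ _ t0 hth sp.
have [tp' E'] := level_spiral _ _ t0' hth' sp'.
move: E; rewrite Ex Ey E' => /addIr/addIr H; apply/esym; exact: (ln_inj _ _ H).
Qed.

Lemma spiral_cover x y : 0 <= y ->
  exists t th, [/\ 0 <= t, 0 <= th <= pi, x = sx t th & y = sy t th].
Proof.
move=> y0.
set N := Num.sqrt ((x + 1) ^+ 2 + y ^+ 2).
have N2 : N ^+ 2 = (x + 1) ^+ 2 + y ^+ 2 by rewrite sqr_sqrtr// addr_ge0 ?sqr_ge0.
have N0 : 0 <= N by exact: sqrtr_ge0.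
have [N00|Nn0] := eqVneq N 0.
  move: N2; rewrite N00 expr0n/= => /esym/eqP; rewrite paddr_eq0 ?sqr_ge0//.
  rewrite !sqrf_eq0 => /andP[/eqP x1 /eqP y00].
  exists 0, 0; rewrite /sx /sy /sradius !mul0r lexx pi_ge0; split=> //.
  by rewrite addr0; lra.
have Np : 0 < N by rewrite lt_neqAle eq_sym Nn0.
set c := (x + 1) / N.
have c2 : c ^+ 2 = 1 - (y / N) ^+ 2.
  have : (x + 1) ^+ 2 = N ^+ 2 - y ^+ 2 by rewrite N2 addrK.
  by rewrite /c !expr_div_n => ->; field.
have cb : -1 <= c <= 1.
  have : c ^+ 2 <= 1 by rewrite c2 lerBlDr lerDl sqr_ge0.
  by move=> c1; apply/andP; split; nra.
(* Polar coordinates around [-1]; the exponential undoes the decay accumulated up to the angle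
   [acos c]. *)
exists (N * expR (k * acos c) / spiral_scale), (acos c).
have Rn : spiral_scale != 0 by rewrite gt_eqF ?spiral_scale_gt0.
have E : sradius (N * expR (k * acos c) / spiral_scale) (acos c) = N.
  by rewrite /sradius divfK// mulNr expRN mulfK// gt_eqF ?expR_gt0.
split.
- exact: divr_ge0 (mulr_ge0 N0 (expR_ge0 _)) (ltW spiral_scale_gt0).
- by rewrite acos_ge0// acos_lepi.
- by rewrite /sx E acosK ?in_itv//= /c; field.
- rewrite /sy E sin_acos// c2 opprB addrC subrK sqrtr_sqr ger0_norm ?divr_ge0//.
  by field.
Qed.

Lemma sy_eq0_of_opp t th t' th' : 0 <= t -> 0 <= th <= pi -> 0 <= t' ->
    0 <= th' <= pi ->
  sy t th = - sy t' th' -> sy t th = 0 /\ sy t' th' = 0.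
Proof.
move=> t0 hth t0' hth' E.
have := sy_ge0 _ _ t0 hth; have := sy_ge0 _ _ t0' hth'; lra.
Qed.

(** * Topology of the regions cut out by the orbit *)

Variable F : frame R.

Lemma signr_inj (e : bool) (x y : R) : (-1) ^+ e * x = (-1) ^+ e * y -> x = y.
Proof. by apply: mulfI; rewrite signr_eq0. Qed.

(** [e] selects the spirals around [-1] in the upper half plane or their
    images by [z |-> - z], around [1]; the orbit is [t = 1]. *)
Definition spiral (e : bool) (t th : R) : 'cV[R]_2 :=
  pt F ((-1) ^+ e * sx t th) ((-1) ^+ e * sy t th).

Definition region (J : set R) : set 'cV[R]_2 :=
  [set v | exists e t th, [/\ J t, 0 <= t, 0 <= th <= pi & v = spiral e t th]].

Definition inside := region [set t | t < 1].
Definition curve := region [set t | t = 1].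
Definition outside := region [set t | 1 < t].

(** The two families meet only on the real axis, where a point can have several parameters [t].
    Their position relative to 1 is still well defined, being that of the modulus relative to
    [vertex]. *)
Lemma spiral_level e t th e' t' th' : 0 <= t -> 0 <= th <= pi -> 0 <= t' ->
    0 <= th' <= pi ->
  spiral e t th = spiral e' t' th' -> ((t < 1) = (t' < 1)) * ((t <= 1) = (t' <= 1)).
Proof.
move=> t0 hth t0' hth' E.
have Ex := congr1 (cx F) E; have Ey := congr1 (cy F) E.
rewrite /spiral !ptK1 !ptK2 in Ex Ey.
have [ee|ee] := eqVneq e e'.
  subst e'; move/signr_inj: Ex => Ex; move/signr_inj: Ey => Ey.
  have [s0|sn0] := eqVneq (sy t th) 0.
    rewrite !(real_axis_level _ _ t0 hth s0).
    by rewrite Ex -!(real_axis_level _ _ t0' hth')// -Ey.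
  have sp : 0 < sy t th by rewrite lt_neqAle eq_sym sn0 sy_ge0.
  by rewrite (level_spiral_inj _ _ _ _ t0 hth t0' hth' sp Ex Ey).
have eE : e' = ~~ e by move: ee; case: (e); case: (e').
rewrite {}eE in Ex Ey.
have EN z : (-1) ^+ (~~ e) * z = (-1) ^+ e * (- z) :> R.
  by rewrite signrN mulNr mulrN.
rewrite !EN in Ex Ey; move/signr_inj: Ex => Ex; move/signr_inj: Ey => Ey.
have [s0 s0'] := sy_eq0_of_opp _ _ _ _ t0 hth t0' hth' Ey.
by rewrite !(real_axis_level _ _ t0 hth s0) !(real_axis_level _ _ t0' hth' s0') Ex
  normrN.
Qed.

Lemma region_cover v : exists e t th, [/\ 0 <= t, 0 <= th <= pi & v = spiral e t th].
Proof.
have [y0|y0] := leP 0 (cy F v).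
  have [t [th [t0 hth Ex Ey]]] := spiral_cover (cx F v) _ y0.
  by exists false, t, th; split=> //; rewrite /spiral expr0 !mul1r -Ex -Ey ptK.
have y0' : 0 <= - cy F v by rewrite oppr_ge0 ltW.
have [t [th [t0 hth Ex Ey]]] := spiral_cover (- cx F v) _ y0'.
by exists true, t, th; split=> //; rewrite /spiral expr1 !mulN1r -Ex -Ey !opprK ptK.
Qed.

Lemma regionW (J J' : set R) : J `<=` J' -> region J `<=` region J'.
Proof.
by move=> JJ v [e [t [th [Jt t0 hth ->]]]]; exists e, t, th; split=> //; exact: JJ.
Qed.

Lemma insideNcurve : inside `<=` ~` curve.
Proof.
move=> v [e [t [th [/= t1 t0 hth ->]]]] [e' [t' [th' [/= t1' t0' hth' E]]]].
by have := spiral_level _ _ _ _ _ _ t0 hth t0' hth' E; rewrite t1 t1' ltxx => -[].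
Qed.

Lemma insideNoutside : inside `<=` ~` outside.
Proof.
move=> v [e [t [th [/= t1 t0 hth ->]]]] [e' [t' [th' [/= t1' t0' hth' E]]]].
by have := spiral_level _ _ _ _ _ _ t0 hth t0' hth' E;
  rewrite t1 ltNge (ltW t1') => -[].
Qed.

Lemma curveNoutside : curve `<=` ~` outside.
Proof.
move=> v [e [t [th [/= t1 t0 hth ->]]]] [e' [t' [th' [/= t1' t0' hth' E]]]].
by have := spiral_level _ _ _ _ _ _ t0 hth t0' hth' E; rewrite t1 lexx leNgt t1' => -[].
Qed.

Lemma region_trichotomy v : inside v \/ curve v \/ outside v.
Proof.
have [e [t [th [t0 hth ->]]]] := region_cover v.
case: (ltgtP t 1) => t1; [left|right; right|right; left];
  by exists e, t, th; split.
Qed.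

Definition hull := region [set t | t <= 1].

Lemma hullE : hull = inside `|` curve.
Proof.
apply/seteqP; split=> [v [e [t [th [/= + t0 hth ->]]]]|v [|]].
- by rewrite le_eqVlt => /orP[/eqP t1|t1]; [right|left]; exists e, t, th.
- by apply: regionW => t /= /ltW.
- by apply: regionW => t /= ->.
Qed.

Lemma hullNoutside : hull = ~` outside.
Proof.
rewrite hullE; apply/seteqP; split=> v.
  by case; [exact: insideNoutside|exact: curveNoutside].
by case: (region_trichotomy v) => [|[|//]]; [left|right].
Qed.

Lemma insideC : ~` inside = region [set t | 1 <= t].
Proof.
apply/seteqP; split=> v.
  case: (region_trichotomy v) => [//|[|] H _]; apply: regionW H => t /=;
    first by move->.
  exact: ltW.
move=> [e [t [th [/= t1 t0 hth ->]]]] [e' [t' [th' [/= t1' t0' hth' E]]]].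
by have := spiral_level _ _ _ _ _ _ t0 hth t0' hth' E; rewrite t1' ltNge t1 => -[].
Qed.

Lemma continuous_spiral (T : topologicalType) e (f g : T -> R) (s : T) :
  {for s, continuous f} -> {for s, continuous g} ->
  {for s, continuous (fun s => spiral e (f s) (g s))}.
Proof.
move=> cf cg.
have ccos : {for s, continuous (fun s => cos (g s))}.
  by apply: continuous_comp; [exact: cg|exact: continuous_cos].
have csin : {for s, continuous (fun s => sin (g s))}.
  by apply: continuous_comp; [exact: cg|exact: continuous_sin].
have cexp : {for s, continuous (fun s => expR (- k * g s))}.
  apply: (@continuous_comp _ _ _ (fun s => - k * g s) expR).
    by apply: continuousM; [exact: cst_continuous|exact: cg].
  exact: continuous_expR.
have cr : {for s, continuous (fun s => sradius (f s) (g s))}.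
  apply: continuousM; last exact: cexp.
  by apply: continuousM; [exact: cf|exact: cst_continuous].
apply: pt_continuous; (apply: continuousM; first exact: cst_continuous).
  apply: continuousD; first exact: cst_continuous.
  by apply: continuousM; [exact: cr|exact: ccos].
by apply: continuousM; [exact: cr|exact: csin].
Qed.

Lemma compact_spiral e a b :
  compact [set v | exists t th, [/\ a <= t <= b, 0 <= th <= pi & v = spiral e t th]].
Proof.
have -> : [set v | exists t th, [/\ a <= t <= b, 0 <= th <= pi & v = spiral e t th]] =
    (fun p : R * R => spiral e p.1 p.2) @` (`[a, b] `*` `[0, pi]).
  apply/seteqP; split=> [v [t [th [tab hth ->]]]|v [[t th] [/= tab hth] <-]].
    by exists (t, th) => //; split; rewrite /= in_itv.
  by exists t, th; move: tab hth; rewrite !in_itv.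
apply: continuous_compact; last by apply: compact_setX; exact: segment_compact.
apply: continuous_subspaceT => p.
by apply: continuous_spiral; [exact: cvg_fst|exact: cvg_snd].
Qed.

Lemma compact_region a b : 0 <= a -> compact (region [set t | a <= t <= b]).
Proof.
move=> a0; rewrite (_ : region _ =
    [set v | exists t th, [/\ a <= t <= b, 0 <= th <= pi & v = spiral false t th]] `|`
    [set v | exists t th, [/\ a <= t <= b, 0 <= th <= pi & v = spiral true t th]]).
  by apply: compactU; exact: compact_spiral.
apply/seteqP; split=> [v [[] [t [th [/= tab t0 hth ->]]]]|v].
- by right; exists t, th.
- by left; exists t, th.
- by case=> -[t [th [tab hth ->]]]; [exists false|exists true]; exists t, th;
  split=> //;
    case/andP: tab => /(le_trans a0).
Qed.

Lemma compact_hull : compact hull.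
Proof.
rewrite (_ : hull = region [set t | 0 <= t <= 1]); first exact: compact_region.
apply/seteqP; split; last by apply: regionW => t /= /andP[].
by move=> v [e [t [th [/= t1 t0 hth ->]]]]; exists e, t, th; rewrite /= t0.
Qed.

Lemma closed_hull : closed hull.
Proof. by apply: compact_closed; [exact: norm_hausdorff|exact: compact_hull]. Qed.

(** The radius is at least [t * spiral_scale * decay], so [t] stays bounded over bounded sets. This
    properness gives the closedness of unbounded regions. *)
Lemma spiral_bound e t th : 0 <= t -> 0 <= th <= pi ->
  t * (vertex - 1) <= `|cx F (spiral e t th)| + `|cy F (spiral e t th)| + 1.
Proof.
move=> t0 /andP[th0 thpi];
  rewrite /spiral ptK1 ptK2 !(normrM ((-1) ^+ e)) !normr_sign !mul1r.
have rr : t * (vertex - 1) <= sradius t th.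
  rewrite -spiral_scale_decay /sradius mulrA.
  apply: ler_wpM2l; first exact: mulr_ge0 t0 (ltW spiral_scale_gt0).
  by rewrite /decay ler_expR !mulNr lerN2 ler_pM2l.
apply: le_trans rr _; have r0 := sradius_ge0 t th t0.
have c1 := cos_max th; have s1 := sin_max th.
have E : sradius t th * cos th = sx t th + 1 by rewrite /sx; ring.
have E2 : `|sradius t th * cos th| <= `|sx t th| + 1.
  by rewrite E (le_trans (ler_normD _ _))// normr1.
have E3 : sradius t th <= `|sradius t th * cos th| + `|sy t th|.
  rewrite /sy; move: (sradius t th) r0 => z z0.
  rewrite !normrM (ger0_norm z0) -mulrDr ler_peMr//.
  rewrite -(cos2Dsin2 th) -[cos th ^+ 2]real_normK ?num_real// -[sin th ^+
    2]real_normK ?num_real//.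
  have := normr_ge0 (cos th); have := normr_ge0 (sin th); nra.
by lra.
Qed.

Lemma closed_region_ge a : 0 <= a -> closed (region [set t | a <= t]).
Proof.
move=> a0 v vcl; have v1 := vertex_gt1.
(* The [3] is the [1] of [spiral_bound] plus an error below 1 for each of the two coordinates of a
   nearby point. *)
pose M := (`|cx F v| + `|cy F v| + 3) / (vertex - 1).
have cK : closed (region [set t | a <= t <= M]).
  by apply: compact_closed; [exact: norm_hausdorff|exact: compact_region].
suff : region [set t | a <= t <= M] v by apply: regionW => t /= /andP[].
apply: cK => B Bv.
have [x1 x2] : (\forall w \near v, `|cx F v - cx F w| < 1) /\ (\forall w \near v,
  `|cy F v - cy F w| < 1).
  split.
    by have /cvgrPdist_lt := cx_continuous F v; apply.
  by have /cvgrPdist_lt := cy_continuous F v; apply.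
have [w [[e [t [th [/= at_ t0 hth wE]]]] [[Bw w1] w2]]] :=
  vcl _ (filterI (filterI Bv x1) x2).
exists w; split=> //; exists e, t, th; split=> //=;
  rewrite at_/= /M ler_pdivlMr ?subr_gt0//.
apply: le_trans (spiral_bound e _ _ t0 hth) _; rewrite -wE.
have := ler_distD 0 (cx F w) (cx F v); have := ler_distD 0 (cy F w) (cy F v).
have := lerB_dist (cx F w) (cx F v); have := lerB_dist (cy F w) (cy F v).
rewrite /= in w1 w2; rewrite [`|cx F w - _|]distrC [`|cy F w - _|]distrC; lra.
Qed.

Lemma open_inside : open inside.
Proof. by rewrite -[inside]setCK insideC; apply: closed_openC;
  exact: closed_region_ge. Qed.

Lemma spiral_continuousl e (t th : R) : {for t, continuous (fun t => spiral e t th)}.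
Proof. by apply: continuous_spiral => //; exact: cst_continuous. Qed.

Lemma spiral_continuousr e (t th : R) : {for th, continuous (fun th => spiral e t th)}.
Proof. by apply: continuous_spiral => //; exact: cst_continuous. Qed.

(** The set is a comb: every half spiral is attached to the spine [th = 0]. *)
Lemma connected_half e (J : set R) : is_interval J ->
  connected [set v | exists t th, [/\ J t, 0 <= th <= pi & v = spiral e t th]].
Proof.
move=> iJ.
have cL : connected ((fun t => spiral e t 0) @` J).
  apply: connected_continuous_connected; first exact/connected_intervalP.
  by apply: continuous_subspaceT => t; exact: spiral_continuousl.
have cA t : connected ((fun th => spiral e t th) @` `[0, pi]).
  apply: connected_continuous_connected; first exact: segment_connected.
  by apply: continuous_subspaceT => th; exact: spiral_continuousr.
have h0 : `[0, pi]%classic (0 : R) by rewrite /= in_itv/= lexx pi_ge0.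
have [->|/set0P[t0 Jt0]] := eqVneq J set0.
  rewrite (_ : [set v | _] = set0); first exact: connected0.
  by rewrite -subset0 => v [t [th []]].
rewrite (_ : [set v | _] =
  \bigcup_(t in J) ((fun t => spiral e t 0) @` J `|` (fun th =>
    spiral e t th) @` `[0, pi])).
  apply: bigcup_connected.
    by exists (spiral e t0 0) => t Jt; left; exists t0.
  move=> t Jt; apply: connectedU => //.
  by exists (spiral e t 0); split; [exists t|exists 0].
apply/seteqP; split=> [v [t [th [Jt hth ->]]]|v [t Jt [[s Js <-]|[th hth <-]]]].
- by exists t => //; right; exists th => //; rewrite /= in_itv.
- by exists s, 0; rewrite lexx pi_ge0.
- by exists t, th; split=> //; move: hth; rewrite /= in_itv.
Qed.

Lemma connected_region (J : set R) t t' th' : is_interval J ->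
    J `<=` [set t | 0 <= t] ->
  J t -> J t' -> 0 <= th' <= pi -> spiral false t 0 = spiral true t' th' ->
  connected (region J).
Proof.
move=> iJ J0 Jt Jt' hth' E.
rewrite (_ : region J =
    [set v | exists t th, [/\ J t, 0 <= th <= pi & v = spiral false t th]] `|`
    [set v | exists t th, [/\ J t, 0 <= th <= pi & v = spiral true t th]]).
  apply: connectedU; [|exact: connected_half|exact: connected_half].
  exists (spiral false t 0); split; first by exists t, 0; rewrite lexx pi_ge0.
  by exists t', th'.
apply/seteqP; split=> [v [[] [s [th [Js s0 hth ->]]]]|v].
- by right; exists s, th.
- by left; exists s, th.
- by case=> -[s [th [Js hth ->]]]; [exists false|exists true]; exists s, th; split=> //;
    exact: (J0 _ Js).
Qed.

Lemma connected_inside : connected inside.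
Proof.
have r0 := spiral_scale_gt0; have v1 := vertex_gt1; have rE := spiral_scaleE.
rewrite (_ : inside = region [set t | 0 <= t < 1]); last first.
  apply/seteqP; split; last by apply: regionW => t /= /andP[].
  by move=> v [e [t [th [/= t1 t0 hth ->]]]]; exists e, t, th; rewrite /= t0.
(* At this parameter both families start at the origin, the fixed point of the symmetry. *)
apply: (connected_region _ (spiral_scale^-1) (spiral_scale^-1) 0).
- move=> x y /= /andP[x0 x1] /andP[y0 y1] z /andP[xz zy].
  by rewrite (le_trans x0 xz) (le_lt_trans zy y1).
- by move=> t /= /andP[].
- by rewrite /= invr_ge0 (ltW r0) invf_lt1// rE; lra.
- by rewrite /= invr_ge0 (ltW r0) invf_lt1// rE; lra.
- by rewrite lexx pi_ge0.
- rewrite /spiral !sx0 !sy0 mulVf ?gt_eqF//.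
  by congr pt; ring.
Qed.

Lemma connected_outside : connected outside.
Proof.
have v1 := vertex_gt1.
(* The common point is [2 * vertex - 1] on the real axis: a start in the first family, an end with
   [t = 2] in the second. *)
apply: (connected_region _ (2 * vertex / spiral_scale) 2 pi).
- move=> x y /= x1 y1 z /andP[xz zy]; exact: lt_le_trans xz.
- by move=> t /= /ltW; apply: le_trans.
- by rewrite /= spiral_scaleE ltr_pdivlMr; lra.
- by rewrite /=; lra.
- by rewrite lexx pi_ge0.
- rewrite /spiral sx0 sy0 sxpi sypi divfK ?gt_eqF ?spiral_scale_gt0//.
  by congr pt; rewrite ?expr0 ?expr1; ring.
Qed.

Lemma closure_inside : closure inside = hull.
Proof.
apply/seteqP; split.
  rewrite {1}((closure_id _).1 closed_hull).
  by apply: closure_subset; rewrite hullE => v; left.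
rewrite hullE => v [|[e [t' [th [/= -> _ hth ->]]]] B]; first exact: subset_closure.
move=> /spiral_continuousl Bn.
have [t [[Bt /= t1] t0]] : exists t : R, (B (spiral e t th) /\ t < 1) /\ 0 < t.
  apply: (@filter_ex _ (1 : R)^'-); apply: filterI; first apply: filterI.
  - by apply: (@filterS _ (nbhs (1 : R)) _ _ _ _ Bn) => z Bz _.
  - exact: nbhs_left_lt.
  - exact: nbhs_left_gt.
by exists (spiral e t th); split=> //; exists e, t, th; split=> //; exact: ltW.
Qed.

Lemma interior_hull : interior hull = inside.
Proof.
apply/seteqP; split; last first.
  rewrite -open_subsetE; last exact: open_inside.
  by rewrite hullE => v; left.
move=> v /[dup] /interior_subset; rewrite hullE => -[//|].
move=> [e [t' [th [/= -> _ hth ->]]]] /spiral_continuousl Bn; exfalso.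
have [t [Bt /= t1]] : exists t : R, (inside `|` curve) (spiral e t th) /\ 1 < t.
  apply: (@filter_ex _ (1 : R)^'+); apply: filterI.
  - by apply: (@filterS _ (nbhs (1 : R)) _ _ _ _ Bn) => z Bz _.
  - exact: nbhs_right_gt.
rewrite -hullE hullNoutside in Bt; apply: Bt; exists e, t, th; split=> //.
by rewrite (le_trans ler01)// ltW.
Qed.

Lemma bounded_inside : bounded_set inside.
Proof.
have [M [Mr H]] := compact_bounded compact_hull.
by exists M; split=> // x Mx v iv; apply: H => //; rewrite hullE; left.
Qed.

Lemma outside_pt x : vertex < x -> outside (pt F x 0).
Proof.
move=> vx; have r0 := spiral_scale_gt0; have v1 := vertex_gt1.
exists false, ((x + 1) / spiral_scale), 0; split.
- by rewrite /= ltr_pdivlMr// spiral_scaleE; lra.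
- by rewrite divr_ge0 ?(ltW r0)//; lra.
- by rewrite lexx pi_ge0.
- by rewrite /spiral sx0 sy0 divfK ?gt_eqF// expr0 !mul1r addrC addrK.
Qed.

Lemma unbounded_outside : ~ bounded_set outside.
Proof.
move=> [M [Mr H]].
have M1 : M < M + 1 by lra.
have e0 : 0 < `|ex F|.
  rewrite normr_gt0; apply/eqP => E; have := @frame_free _ F.
  by rewrite E !mxE !mul0r subrr eqxx.
pose x := vertex + 1 + (`|M| + `|org F| + 2) / `|ex F|.
have h0 : 0 <= (`|M| + `|org F| + 2) / `|ex F| by rewrite divr_ge0// !addr_ge0.
have v1 := vertex_gt1.
have vx : vertex < x by rewrite /x; lra.
have := H _ M1 _ (outside_pt _ vx); rewrite /= => H1.
have H2 : x * `|ex F| <= `|pt F x 0| + `|org F|.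
  have xE : x *: ex F = pt F x 0 - org F by rewrite /pt scale0r addr0 addrC addKr.
  have -> : x * `|ex F| = `|x *: ex F|.
    by rewrite normrZ (gtr0_norm (lt_trans (lt_trans ltr01 v1) vx)).
  by rewrite xE ler_normB.
have H3 : (vertex + 1) * `|ex F| + (`|M| + `|org F| + 2) = x * `|ex F|.
  by rewrite /x; field; rewrite gt_eqF.
have := ler_norm M; have : 0 < (vertex + 1) * `|ex F| by rewrite mulr_gt0//; lra.
lra.
Qed.

Lemma separated_inside_outside : separated inside outside.
Proof.
split; rewrite -subset0 => v [].
  by rewrite closure_inside hullNoutside.
move=> iv ov; have := ov _ (open_nbhs_nbhs (conj open_inside iv)).
by move=> [w [ow iw]]; exact: insideNoutside iw ow.
Qed.

(** [inside] and [outside] are connected and separated, hence are the components of the complement.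
    Only the first is bounded, so the definite description has a unique candidate. *)
Lemma delimited_curve : delimited_region curve = inside.
Proof.
have sub v : (~` curve) v -> inside v \/ outside v.
  by case: (region_trichotomy v) => [|[|]]; [left| |right].
have comp v : (~` curve) v ->
    connected_component (~` curve) v `<=` inside \/
      connected_component (~` curve) v `<=` outside.
  move=> cv; apply: (connected_subset separated_inside_outside);
    last exact: component_connected.
  by move=> w /connected_component_sub/sub.
have oN : outside `<=` ~` curve by move=> v ov cv; exact: (curveNoutside _ cv).
apply: xget_unique.
  split; first exact: bounded_inside.
  have r0 := spiral_scale_gt0.
  have i0 : inside (spiral false 0 0) by exists false, 0, 0; rewrite /= lexx pi_ge0.
  have c0 := insideNcurve _ i0.
  exists (spiral false 0 0) => //; apply/seteqP; split.
    by apply: connected_component_max => //;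
      [exact: insideNcurve|exact: connected_inside].
  case: (comp _ c0) => // H.
  by have := H _ (connected_component_refl c0) => /(insideNoutside _ i0).
move=> K [Kb [v cv KE]].
case: (sub _ cv) => [iv|ov].
  rewrite KE; apply/seteqP; split; last first.
    by apply: connected_component_max => //;
      [exact: insideNcurve|exact: connected_inside].
  case: (comp _ cv) => // H.
  by have := H _ (connected_component_refl cv) => /(insideNoutside _ iv).
exfalso; apply: unbounded_outside.
have oK : outside `<=` K.
  by rewrite KE; apply: connected_component_max => //; exact: connected_outside.
by move: Kb => [M [Mr H]]; exists M; split=> // x Mx w /oK; exact: H.
Qed.

End Spiral.

(** * Composition and reversal of orbits *)

Lemma positive_orbit_trans {R : realType} {A : 'M[R]_2} {eta} {um up : R} {v} w {z}
    : um < up ->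
  positive_orbit A eta um up v w -> positive_orbit A eta um up w z ->
  positive_orbit A eta um up v z.
Proof.
move=> umup [u1 [x1 [s1 [cu1 tx1 s10 wE]]]] [u2 [x2 [s2 [cu2 tx2 s20 zE]]]].
rewrite wE in tx2.
have [u cu tx] := trajectory_concat umup s10 cu1 tx1 cu2 tx2.
exists u, (fun s => if s < s1 then x1 s else x2 (s - s1)), (s1 + s2); split=> //.
  by rewrite addr_ge0.
by rewrite ltNge lerDl s20/= addrC addKr.
Qed.

Lemma positive_orbit_rev {R : realType} {A : 'M[R]_2} {eta} {um up : R} {v w} :
  positive_orbit A eta um up v w -> positive_orbit (- A) (- eta) um up w v.
Proof.
move=> [u [x [s [cu tx s0 wE]]]].
exists (fun z => u (s - z)), (fun z => x (s - z)), s; split=> //.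
- exact: controls_compN.
- by rewrite wE; exact: (trajectory_compN _ tx).
- by rewrite subrr; case: tx.
Qed.

(** * The system in the stable case and its time reversal *)

(** Parity of integers of either sign: half periods are numbered over all times, past ones
    included. *)
Definition zodd (n : int) : bool := ((n %% 2)%Z == 1).

Lemma zodd_pred n : zodd (n - 1) = ~~ zodd n.
Proof. by rewrite /zodd; lia. Qed.

Lemma zodd_shift (e : bool) (N : nat) : zodd ((e : nat)%:Z - 2 * N%:Z) = e.
Proof. by rewrite /zodd; case: e; lia. Qed.

Section StableSystem.
Context {R : realType}.
Context {F : frame R} {A : 'M[R]_2} {eta : 'cV[R]_2} {um up a b : R}.
Hypotheses (umup : um < up) (FA : adapted F A eta um up a b) (a0 : a < 0) (b0 : 0 < b).

Let k := - a / b.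
Local Notation reach := (positive_orbit A eta um up).

Lemma rate_gt0 : 0 < k.
Proof. by rewrite divr_gt0// oppr_gt0. Qed.
Let k0 : 0 < k := rate_gt0.

Lemma signr_bound (e : bool) : (-1 : R) <= (-1) ^+ e <= (1 : R).
Proof. by case: e; rewrite ?expr0 ?expr1; apply/andP; split; lra. Qed.

(** The factor [exp (a s)] is the decay [exp (- k b s)] over the angle [b s]; hence [t] is constant
    and only the angle moves. *)
Lemma trajectory_spiral e t th :
  trajectory A eta (spiral k F e t th) (cst (ctrl um up (- (-1) ^+ e)))
    (fun s => spiral k F e t (th + b * s)).
Proof.
have := trajectory_rot FA ((-1) ^+ e * sx k t th) ((-1) ^+ e * sy k t th) (- (-1) ^+ e).
rewrite -/(spiral k F e t th).
set x := (fun s => _); set y := (fun s => _); suff -> : x = y by [].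
apply/funext => s; rewrite /x /y /spiral /rotx /roty /sx /sy.
have E : sradius k t (th + b * s) = expR (a * s) * sradius k t th.
  rewrite /sradius (_ : - k * (th + b * s) = a * s + (- k * th)).
    by rewrite expRD; ring.
  by rewrite /k; field; rewrite gt_eqF.
by rewrite E cosD sinD; congr pt; ring.
Qed.

(** * Steering to the origin and away from it *)

Lemma reach_spiral e (t th th' : R) : th <= th' ->
    reach (spiral k F e t th) (spiral k F e t th').
Proof.
move=> thth'; eexists; eexists; exists ((th' - th) / b); split.
- apply: (controls_cst _ _ (- (-1) ^+ e) umup).
  by rewrite lerNr opprK lerNl andbC; exact: signr_bound.
- exact: trajectory_spiral.
- by rewrite divr_ge0 ?subr_ge0// ltW.
- by congr spiral; field; rewrite gt_eqF.
Qed.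

Lemma reach_half_turn (x w : R) : -1 <= w <= 1 ->
  reach (pt F x 0) (pt F ((1 + decay k) * w - decay k * x) 0).
Proof.
move=> wb; eexists; eexists; exists (pi / b); split.
- exact: (controls_cst _ _ _ umup wb).
- exact: (trajectory_rot FA).
- by rewrite divr_ge0 ?pi_ge0// ltW.
- have pE : b * (pi / b) = pi by field; rewrite gt_eqF.
  have aE : a * (pi / b) = - k * pi by rewrite /k; field; rewrite gt_eqF.
  by rewrite /rotx /roty pE aE cospi sinpi -/(decay k); congr pt; ring.
Qed.

Lemma reach_refl v : reach v v.
Proof.
have wb : (-1 : R) <= (0 : R) <= (1 : R) by apply/andP; split; lra.
have tx := trajectory_rot FA (cx F v) (cy F v) 0.
rewrite ptK in tx.
exists (cst (ctrl um up 0)); eexists; exists 0; split; [|exact: tx| |].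
- exact: controls_cst.
- by [].
- by case: tx => ->.
Qed.

Lemma decay_expn_lt (e : R) : 0 < e -> exists n, decay k ^+ n < e.
Proof.
move=> e0; have := @cvg_expr R (decay k); rewrite ger0_norm ?(ltW (decay_gt0 k))//.
move=> /(_ (decay_lt1 k k0)) /cvgrPdist_lt /(_ e e0) [N _ /(_ N (leqnn N))] /=.
by rewrite sub0r normrN normrX ger0_norm ?(ltW (decay_gt0 k))//; exists N.
Qed.

Lemma reach_from_org_real (x : R) : `|x| < vertex k -> reach (org F) (pt F x 0).
Proof.
have r0 := decay_gt0 k; have r1 := decay_lt1 k k0; have v1 := vertex_gt1 k k0.
have vE := vertexE k k0; have o0 : org F = pt F 0 0 by rewrite /pt !scale0r !addr0.
(* The index counts half turns backwards from [x]; at [n = 0] the gap to the vertex is so large that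
   [x = 0]. *)
have H (n : nat) : forall x : R, decay k ^+ n * vertex k <= vertex k - `|x| ->
  reach (org F) (pt F x 0).
  elim: n => [|n IH] {}x.
    rewrite expr0 mul1r => xv; have -> : x = 0.
      by apply/eqP; rewrite -normr_le0; lra.
    by rewrite -o0; exact: reach_refl.
  move=> xv.
  have [x1|x1] := leP `|x| (1 + decay k).
    rewrite o0; have wb : -1 <= x / (1 + decay k) <= 1.
      by rewrite -ler_norml normrM normfV (@ger0_norm _ (1 +
        _)) ?ler_pdivrMr ?mul1r//; lra.
    have := reach_half_turn 0 _ wb; congr (reach _ (pt F _ 0)); field.
    by rewrite gt_eqF//; lra.
  (* Undoing a half turn divides the gap [vertex - |x|] by [decay]. *)
  pose w := Num.sg x; have wb : -1 <= w <= 1.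
    by rewrite /w; case: sgrP => _; apply/andP; split; lra.
  have xE : x = w * `|x| by rewrite /w mulr_sg_norm.
  have xn0 : x != 0 by rewrite -normr_gt0; lra.
  have := reach_half_turn (w * ((1 + decay k - `|x|) / decay k)) _ wb.
  have -> : (1 + decay k) * w - decay k * (w * ((1 + decay k - `|x|) / decay k)) = x.
    by rewrite [RHS]xE; field; rewrite gt_eqF.
  apply: positive_orbit_trans => //; apply: IH.
  rewrite normrM /w normr_sg xn0 mul1r normrM normfV (gtr0_norm r0) ler0_norm;
    last by lra.
  rewrite lerBrDr -lerBrDl ler_pdivrMr//.
  move: xv; rewrite exprS; nra.
move=> xv; have g0 : 0 < (vertex k - `|x|) / vertex k by rewrite divr_gt0
  ?subr_gt0//; lra.
have [n nE] := decay_expn_lt _ g0; apply: (H n).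
by move: nE; rewrite ltr_pdivlMr; [move/ltW|lra].
Qed.

(** Going back to angle 0 along its spiral replaces an interior point by a real one strictly between
    the vertices. *)
Lemma reach_from_org v : inside k F v -> reach (org F) v.
Proof.
have v1 := vertex_gt1 k k0.
move=> [e [t [th [/= t1 t0 /andP[th0 thpi] ->]]]].
apply: (positive_orbit_trans (spiral k F e t 0)) => //; last exact: reach_spiral.
rewrite /spiral sy0 mulr0; apply: reach_from_org_real.
rewrite normrM normr_sign mul1r.
have h0 : 0 <= (0 : R) <= pi by rewrite lexx pi_ge0.
by rewrite -(real_axis_level k k0 t 0 t0 h0 (sy0 k t)).1.
Qed.

Lemma reach_org_real (x : R) : reach (pt F x 0) (org F).
Proof.
have r0 := decay_gt0 k; have r1 := decay_lt1 k k0.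
have o0 : org F = pt F 0 0 by rewrite /pt !scale0r !addr0.
have H (n : nat) : forall x : R, decay k ^+ n * `|x| <= 1 + decay k ->
  reach (pt F x 0) (org F).
  have base y : decay k * `|y| <= 1 + decay k -> reach (pt F y 0) (org F).
    move=> yb; have wb : -1 <= decay k * y / (1 + decay k) <= 1.
      rewrite -ler_norml !normrM normfV (@ger0_norm _ (1 + _)) ?(gtr0_norm r0);
        last by lra.
      by rewrite ler_pdivrMr; lra.
    have := reach_half_turn y _ wb; rewrite o0; congr (reach _ (pt F _ 0)); field.
    by rewrite gt_eqF//; lra.
  elim: n => [|n IH] {}x.
    by rewrite expr0 mul1r => xb; apply: base; have := normr_ge0 x; nra.
  move=> xb; have [x1|x1] := leP (decay k * `|x|) (1 + decay k); first exact: base.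
  (* The extreme center on the side of [x] replaces [|x|] by [decay * |x| - (1 + decay)], which is
     below [decay * |x|]; the modulus shrinks at least geometrically. *)
  pose w := Num.sg x; have wb : -1 <= w <= 1.
    by rewrite /w; case: sgrP => _; apply/andP; split; lra.
  have xE : x = w * `|x| by rewrite /w mulr_sg_norm.
  have xn0 : x != 0 by rewrite -normr_gt0; nra.
  apply: positive_orbit_trans (reach_half_turn x _ wb) _ => //.
  apply: IH.
  have -> : (1 + decay k) * w - decay k * x = w * ((1 + decay k) - decay k * `|x|).
    by rewrite {1}xE; ring.
  rewrite normrM /w normr_sg xn0 mul1r ler0_norm; last by lra.
  have rn : 0 <= decay k ^+ n by rewrite exprn_ge0 ?(ltW r0).
  by move: xb; rewrite exprSr; nra.
have [x00|xn0] := eqVneq `|x| 0.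
  by apply: (H 0%N); rewrite x00 mulr0; lra.
have xp : 0 < `|x| by rewrite lt_neqAle eq_sym xn0 normr_ge0.
have g0 : 0 < (1 + decay k) / `|x| by rewrite divr_gt0//; lra.
have [n nE] := decay_expn_lt _ g0; apply: (H n).
by move: nE; rewrite ltr_pdivlMr; [move/ltW|lra].
Qed.

Lemma reach_org v : reach v (org F).
Proof.
have [e [t [th [t0 /andP[th0 thpi] ->]]]] := region_cover k k0 F v.
apply: (positive_orbit_trans (spiral k F e t pi)) => //; first exact: reach_spiral.
by rewrite /spiral sypi mulr0; exact: reach_org_real.
Qed.

(** * Invariance of the closed region *)

Lemma ctrl_derive u x (s : R) : controls um up u -> {for s, continuous u} ->
  is_derive s 1 x (A *m x s + u s *: eta) -> exists2 w, -1 <= w <= 1 &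
  is_derive s 1 (cx F \o x) (a * (cx F (x s) - w) - b * cy F (x s)) /\
  is_derive s 1 (cy F \o x) (b * (cx F (x s) - w) + a * cy F (x s)).
Proof.
move=> [_ ub] _; have [w wb ->] := ctrl_surj _ _ _ umup (ub s) => xD.
by exists w => //; exact: (is_derive_coords FA).
Qed.

(** For [z' = (a + ib) (z - w)] the derivative of the level is
    [- (1 + w) y (b + a ^+ 2 / b) / ((x + 1) ^+ 2 + y ^+ 2)]. *)
Lemma level_nonincreasing (X Y : R -> R) (t0 t1 : R) :
  (forall s, t0 < s < t1 -> 0 < Y s) ->
  (forall s, t0 < s < t1 -> exists2 w : R, -1 <= w <= 1 &
    is_derive s 1 X (a * (X s - w) - b * Y s) /\
    is_derive s 1 Y (b * (X s - w) + a * Y s)) ->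
  forall s s', t0 < s -> s <= s' -> s' < t1 ->
    level k (X s') (Y s') <= level k (X s) (Y s).
Proof.
move=> Yp XYD s s' t0s ss' s't1.
pose f z := level k (X z) (Y z).
have fD z : t0 < z < t1 -> exists2 d, is_derive z (1 : R) f d & d <= 0.
  move=> tz; have Yz := Yp _ tz; have [w /andP[w1 w2] [XD YD]] := XYD _ tz.
  have N0 : 0 < (X z + 1) ^+ 2 + Y z ^+ 2 by rewrite ltr_wpDl ?sqr_ge0 ?exprn_gt0.
  have Yn : Y z != 0 by rewrite gt_eqF.
  have lnD : is_derive ((X z + 1) ^+ 2 + Y z ^+ 2) 1 (@ln R) ((X z + 1) ^+ 2 +
    Y z ^+ 2)^-1.
    exact: is_derive1_ln.
  pose g z := (X z + 1) ^+ 2 + Y z ^+ 2.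
  have gD : is_derive z (1 : R) g
      (2 * (X z + 1) * (a * (X z - w) - b * Y z) + 2 * Y z * (b * (X z - w) + a * Y z)).
    rewrite /g; apply: is_derive_eq; rewrite /GRing.scale /=; ring.
  pose h z := (X z + 1) / Y z.
  have hD : is_derive z (1 : R) h
      (((a * (X z - w) - b * Y z) * Y z - (X z + 1) * (b * (X z - w) +
        a * Y z)) / Y z ^+ 2).
    have VD : is_derive z (1 : R) (fun z =>
      (Y z)^-1) (- (Y z) ^- 2 * (b * (X z - w) + a * Y z)).
      exact: is_deriveV.
    rewrite /h; apply: is_derive_eq; rewrite /GRing.scale /=; field; exact: Yn.
  have aD : is_derive (h z) 1 (@atan R) (1 + h z ^+ 2)^-1 by exact: is_derive1_atan.
  have lgD := @is_derive1_comp _ (@ln R) g z _ _ lnD gD.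
  have ahD := @is_derive1_comp _ (@atan R) h z _ _ aD hD.
  have fE : f = (fun z => (@ln R \o g) z * 2^-1 - k * (@atan R \o h) z) by [].
  eexists; first by rewrite fE; apply: is_derive_eq.
  rewrite /GRing.scale /= /h.
  rewrite [leLHS](_ : _ = - ((1 + w) * Y z * (b + a ^+ 2 / b) / ((X z + 1) ^+ 2 +
    Y z ^+ 2))).
    rewrite oppr_le0 divr_ge0 ?(ltW N0)// !mulr_ge0 ?(ltW Yz)//; first by lra.
    by rewrite addr_ge0 ?(ltW b0)// divr_ge0 ?sqr_ge0 ?(ltW b0).
  have -> : 1 + ((X z + 1) / Y z) ^+ 2 = ((X z + 1) ^+ 2 + Y z ^+ 2) / Y z ^+ 2.
    by field.
  rewrite /k; field; rewrite Yn (gt_eqF b0) (gt_eqF N0) /=.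
  by [].
have dD z : z \in `]s, s'[ -> exists2 d, is_derive z (1 : R) f d & d <= 0.
  rewrite in_itv/= => /andP[sz zs']; apply: fD.
  by rewrite (lt_trans t0s sz) (lt_trans zs' s't1).
apply: (@ler0_derive1_le_cc R f s s') => //; last 2 first.
- by rewrite in_itv/= ss' lexx.
- by rewrite in_itv/= ss' lexx.
- by move=> z /dD[d [fd _] _].
- by move=> z /dD[d [fd fE] d0]; rewrite derive1E fE.
- apply: derivable_within_continuous => z; rewrite in_itv/= => /andP[sz zs'].
  have [|d [fd _] _] := fD z;
    first by rewrite (lt_le_trans t0s sz) (le_lt_trans zs' s't1).
  exact: fd.
Qed.

(** Finitely many discontinuities other than [t0] form a closed set that misses [t0]. A jump at [t0]
    itself is allowed. *)
Lemma discontinuity_free_right u (t0 : R) : controls um up u ->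
  \forall s \near t0, t0 < s -> forall z, t0 < z -> z <= s -> {for z, continuous u}.
Proof.
move=> [[uf _] _].
have fS := finite_setD [set t0] (uf t0 (t0 + 1)).
have cS : closed ((`[t0, t0 + 1] `&` discontinuities u) `\ t0).
  by apply: compact_closed; [exact: norm_hausdorff|exact: finite_compact].
have [e /= e0 He] : nbhs t0 (~` ((`[t0, t0 + 1] `&` discontinuities u) `\ t0)).
  apply: open_nbhs_nbhs; split; first exact: closed_openC.
  by move=> [_]; apply.
near=> s; move=> t0s z t0z zs; apply: contrapT => du.
have s1 : s < t0 + 1 by near: s; apply: lt_nbhsl; lra.
have se : s < t0 + e by near: s; apply: lt_nbhsl; lra.
apply: (He z).
  by rewrite /ball_ /= ltr_norml; apply/andP; split; lra.
split; last by move=> zE; move: t0z; rewrite zE ltxx.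
by split=> //; rewrite /= in_itv/=; apply/andP; split; lra.
Unshelve. all: by end_near. Qed.

(** A vertex is the end of one half of the orbit and the start of the other. The description as a
    start is kept, since from there every admissible field points into the half plane of that
    half. *)
Lemma curve_exit_point v : curve k F v ->
  exists e th, [/\ 0 <= th <= pi, v = spiral k F e 1 th &
    0 < sy k 1 th \/ (sy k 1 th = 0 /\ sx k 1 th = vertex k)].
Proof.
have v1 := vertex_gt1 k k0.
move=> [e [t [th [/= -> _ /andP[th0 thpi] ->]]]].
have h0 : 0 <= (0 : R) <= pi by rewrite lexx pi_ge0.
have sx1 : sx k 1 0 = vertex k by rewrite sx0 spiral_scaleE//; ring.
have [->|thn0] := eqVneq th 0.
  by exists e, 0; split=> //; right; rewrite sy0.
have [->|thnpi] := eqVneq th pi.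
  exists (~~ e), 0; split=> //; last by right; rewrite sy0.
  rewrite /spiral sypi sy0 sxpi// sx1 signrN; congr pt; ring.
exists e, th; split=> //; first by rewrite th0.
left; apply: mulr_gt0; first exact: sradius_gt0.
by apply: sin_gt0_pi; rewrite !lt_neqAle th0 thpi thnpi eq_sym thn0.
Qed.

Lemma right_limit_closed (x : R -> 'cV[R]_2) (t0 s : R) (C : set 'cV[R]_2) :
  {for t0, continuous x} -> closed C -> t0 < s ->
  (forall z, t0 < z -> z <= s -> C (x z)) -> C (x t0).
Proof.
move=> cx cC t0s H; apply: cC => B Bn; have {}Bn := cx _ Bn.
have [z [[Bz t0z] zs]] : exists z : R, (B (x z) /\ t0 < z) /\ z < s.
  apply: (@filter_ex _ t0^'+); apply: filterI; first apply: filterI.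
  - by apply: (@filterS _ (nbhs t0) _ _ _ _ Bn) => z Bz _.
  - exact: nbhs_right_gt.
  - exact: nbhs_right_lt.
by exists (x z); split=> //; apply: H => //; exact: ltW.
Qed.

Lemma near_gt0 (f : R -> R) (t0 : R) : {for t0, continuous f} -> 0 < f t0 ->
  \forall s \near t0, 0 < f s.
Proof. by move=> cf f0; exact: cf _ (lt_nbhsr f0). Qed.

(** The symmetry [z -> - z], which also changes the sign of [w], brings the point to the upper half
    or to the positive vertex. Just after [t0] the trajectory is then strictly above the axis and
    the control continuous, so that the level is monotone there. *)
Lemma hull_local (v : 'cV[R]_2) u x (t0 : R) : controls um up u ->
    trajectory A eta v u x ->
  hull k F (x t0) -> \forall s \near t0, t0 < s -> hull k F (x s).
Proof.
move=> cu [_ xc dx]; rewrite hullE => -[ix|].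
  have H : \forall s \near t0, inside k F (x s).
    by apply: xc; apply: open_nbhs_nbhs; split=> //; exact: open_inside.
  by apply: filterS H => s is_ _; left.
move=> /(curve_exit_point) [e [th [hth xE Hs]]].
pose X s := (-1) ^+ e * cx F (x s); pose Y s := (-1) ^+ e * cy F (x s).
have XE : X t0 = sx k 1 th.
  by rewrite /X xE /spiral ptK1 mulrA -signr_addb addbb mul1r.
have YE : Y t0 = sy k 1 th.
  by rewrite /Y xE /spiral ptK2 mulrA -signr_addb addbb mul1r.
have xXY s : x s = pt F ((-1) ^+ e * X s) ((-1) ^+ e * Y s).
  by rewrite /X /Y !mulrA -!signr_addb addbb !mul1r ptK.
have cX : continuous X.
  suff H (s : R) : {for s, continuous X} by exact: H.
  apply: continuousM; first exact: cst_continuous.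
  by apply: continuous_comp; [exact: xc|exact: cx_continuous].
have cY : continuous Y.
  suff H (s : R) : {for s, continuous Y} by exact: H.
  apply: continuousM; first exact: cst_continuous.
  by apply: continuous_comp; [exact: xc|exact: cy_continuous].
have XYD s : {for s, continuous u} -> exists2 w : R, -1 <= w <= 1 &
    is_derive s 1 X (a * (X s - w) - b * Y s) /\
    is_derive s 1 Y (b * (X s - w) + a * Y s).
  move=> us; have [w /andP[w1 w2] [XD YD]] := ctrl_derive _ _ _ cu us (dx _ us).
  exists ((-1) ^+ e * w).
    by case: (e); rewrite ?expr0 ?expr1; apply/andP; split; lra.
  split.
    have := @is_deriveZ _ _ _ (cx F \o x) ((-1) ^+ e) s 1 _ XD.
    rewrite [_ *: _](_ : _ = a * (X s - (-1) ^+ e * w) - b * Y s)//.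
    by rewrite /X /Y /GRing.scale /=; ring.
  have := @is_deriveZ _ _ _ (cy F \o x) ((-1) ^+ e) s 1 _ YD.
  rewrite [_ *: _](_ : _ = b * (X s - (-1) ^+ e * w) + a * Y s)//.
  by rewrite /X /Y /GRing.scale /=; ring.
have ufree := discontinuity_free_right _ t0 cu.
have Ypos : \forall s \near t0, t0 < s -> forall z, t0 < z -> z <= s -> 0 < Y z.
  case: Hs => [sp|[s0 sv]].
    have : \forall s \near t0, 0 < Y s.
      by apply: near_gt0; [exact: cY|rewrite YE].
    move=> [d /= d0 Hd]; near=> s; move=> t0s z t0z zs; apply: Hd => /=.
    have sd : s < t0 + d by near: s; apply: lt_nbhsl; lra.
    by rewrite ltr_norml; apply/andP; split; lra.
  (* Lower bound of the vertical velocity uniform in [w <= 1]. It is positive at the vertex because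
     [vertex] exceeds 1, and the mean value theorem then lifts the trajectory off the axis. *)
  have cG : continuous (fun s => b * (X s - 1) + a * Y s).
    have H (s : R) : {for s, continuous (fun s => b * (X s - 1) + a * Y s)}.
      apply: continuousD; apply: continuousM; try exact: cst_continuous; last exact: cY.
      by apply: continuousB; [exact: cX|exact: cst_continuous].
    exact: H.
  have : \forall s \near t0, 0 < b * (X s - 1) + a * Y s.
    apply: (near_gt0 (fun s => b * (X s - 1) + a * Y s)); first exact: cG.
    rewrite XE YE s0 sv mulr0 addr0 mulr_gt0//.
    by rewrite subr_gt0; exact: vertex_gt1.
  move=> [d /= d0 Hd]; near=> s; move=> t0s z t0z zs.
  have sd : s < t0 + d by near: s; apply: lt_nbhsl; lra.
  have uf : forall z, t0 < z -> z <= s -> {for z, continuous u}.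
    by move: t0s; near: s; exact: ufree.
  pose dY c := derive1 Y c.
  have YD c : t0 < c < z -> is_derive c 1 Y (dY c) /\ 0 < dY c.
    move=> /andP[t0c cz]; have cs : c <= s by lra.
    have [w /andP[w1 w2] [_ YD]] := XYD _ (uf _ t0c cs).
    have dE : dY c = b * (X c - w) + a * Y c by rewrite /dY derive1E; case: YD.
    split; first by rewrite dE.
    have : 0 < b * (X c - 1) + a * Y c.
      by apply: Hd => /=; rewrite ltr_norml; apply/andP; split; lra.
    by rewrite dE => /lt_le_trans; apply; rewrite lerD2r ler_pM2l// lerD2l lerN2.
  have [c| |c ct0z E] := @MVT R Y dY t0 z t0z.
  - by rewrite in_itv/= => /YD[].
  - by apply: continuous_subspaceT.
  - move: E; rewrite YE s0 subr0 => ->; rewrite mulr_gt0 ?subr_gt0//.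
    by move: ct0z; rewrite in_itv/= => /YD[].
have [S [[+ +] t0S]] : exists S : R,
    ((t0 < S -> forall z, t0 < z -> z <= S -> {for z, continuous u}) /\
     (t0 < S -> forall z, t0 < z -> z <= S -> 0 < Y z)) /\ t0 < S.
  apply: (@filter_ex _ t0^'+); apply: filterI; last exact: nbhs_right_gt.
  by apply: filterI; [exact: (@cvg_within _ (nbhs t0) _ _ _ ufree)|
                      exact: (@cvg_within _ (nbhs t0) _ _ _ Ypos)].
move=> /(_ t0S) uf /(_ t0S) Yp.
near=> s; move=> t0s.
have sS : s < S by near: s; exact: lt_nbhsl.
have polar z : t0 < z -> z <= s -> exists t th,
    [/\ 0 < t, 0 <= th <= pi, x z = spiral k F e t th &
      level k (X z) (Y z) = ln t + ln (spiral_scale k) - k * (pi / 2)].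
  move=> t0z zs; have Yz : 0 < Y z by apply: Yp => //; lra.
  have [t [th' [t0' hth' EX EY]]] := spiral_cover k k0 (X z) _ (ltW Yz).
  rewrite EY in Yz; have [tp lE] := level_spiral k k0 t th' t0' hth' Yz.
  by exists t, th'; split=> //; [rewrite xXY EX EY|rewrite EX EY].
(* Leaving [hull] at time [s] would force [t >= t1 > 1] on [(t0, s]], hence also
   at [t0] by closedness. *)
rewrite -hullE; apply: contrapT => nh.
have [t1 [th1 [t1p hth1 xs ls]]] := polar s t0s (lexx s).
have t1g : 1 < t1.
  by rewrite ltNge; apply/negP => t1l; apply: nh; exists e, t1, th1; split=> //;
    exact: ltW.
have : region k F [set t | t1 <= t] (x t0).
  apply: (right_limit_closed _ _ s) => //; first exact: xc.
    by apply: closed_region_ge => //; exact: ltW.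
  move=> z t0z zs; have [t [th' [tp hth' xz lz]]] := polar z t0z zs.
  exists e, t, th'; split=> //; last exact: ltW.
  rewrite /= -ler_ln ?posrE//.
  have : level k (X s) (Y s) <= level k (X z) (Y z).
    apply: (level_nonincreasing X Y t0 S) => //.
      by move=> y /andP[y1 y2]; apply: Yp => //; exact: ltW.
    by move=> y /andP[y1 y2]; apply: XYD; apply: uf => //; exact: ltW.
  by rewrite ls lz; lra.
rewrite xE => -[e' [t [th' [/= tt t0' hth' E]]]].
have := (spiral_level k k0 F _ _ _ _ _ _ ler01 hth t0' hth' E).2.
by rewrite lexx => /esym; rewrite leNgt (lt_le_trans t1g tt).
Unshelve. all: by end_near. Qed.

(** At the supremum of the times up to [s] spent in [hull] the trajectory is still in [hull], by
    closedness, and [hull_local] provides a later such time. *)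
Lemma hull_invariant (v : 'cV[R]_2) u x (s : R) : controls um up u ->
    trajectory A eta v u x ->
  hull k F v -> 0 <= s -> hull k F (x s).
Proof.
move=> cu tx hv s0; have [x0 xc _] := tx.
apply: contrapT => ns.
pose S := [set z | 0 <= z <= s /\ hull k F (x z)].
have S0 : S 0 by split; [rewrite lexx|rewrite x0].
have supS : has_sup S by split; [exists 0|exists s => z [/andP[]]].
set t0 := sup S.
have t00 : 0 <= t0 by exact: ub_le_sup supS.2 _ S0.
have t0s : t0 <= s by apply: sup_le_ub => //; [exists 0|move=> z [/andP[]]].
have ht0 : hull k F (x t0).
  apply: closed_hull => // B /xc [d /= d0 Bd].
  have [z Sz tz] := sup_adherent d0 supS.
  have zt := ub_le_sup supS.2 Sz.
  case: Sz => _ hz; exists (x z); split=> //; apply: Bd => /=.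
  by rewrite /ball_ /= ltr_norml; apply/andP; split; rewrite -/t0 in zt tz *; lra.
have t0s' : t0 < s.
  by rewrite lt_neqAle t0s andbT; apply/eqP => E; apply: ns; rewrite -E.
have [z [[hz t0z] zs]] : exists z : R, ((t0 < z -> hull k F (x z)) /\ t0 < z) /\ z < s.
  apply: (@filter_ex _ t0^'+); apply: filterI; first apply: filterI.
  - exact: (@cvg_within _ (nbhs t0) _ _ _ (hull_local _ _ _ _ cu tx ht0)).
  - exact: nbhs_right_gt.
  - exact: nbhs_right_lt.
have : z <= t0.
  apply: ub_le_sup supS.2 _ _; split; last exact: hz.
  by rewrite (le_trans t00 (ltW t0z)) ltW.
by rewrite leNgt t0z.
Qed.

(** [z'] is the point to which the same control steers [z]. *)
Lemma hull_contraction v z u x (s : R) : controls um up u -> trajectory A eta v u x ->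
  hull k F z -> 0 <= s ->
  exists2 z', hull k F z' &
    (cx F (x s) - cx F z') ^+ 2 + (cy F (x s) - cy F z') ^+ 2 =
    expR (a * s) ^+ 2 * ((cx F v - cx F z) ^+ 2 + (cy F v - cy F z) ^+ 2).
Proof.
move=> cu tx hz s0.
have := trajectory_translate FA _ _ _ (cx F z - cx F v) (cy F z - cy F v) tx.
rewrite !subrKC ptK => tx'.
exists (pt F (cx F (x s) + rotx a b s (cx F z - cx F v) (cy F z - cy F v))
  (cy F (x s) + roty a b s (cx F z - cx F v) (cy F z - cy F v))).
  exact: (hull_invariant _ _ _ _ cu tx').
rewrite ptK1 ptK2 !opprD !addrA !subrr !add0r !sqrrN rot_norm.
by congr (_ * (_ + _)); rewrite -sqrrN opprB.
Qed.

(** * The square wave control along the orbit *)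

Section Periodic.
Let T : R := pi / b.

(** Number of the half period containing [s], each being closed on the left and open on the
    right. *)
Definition cell (s : R) : int := Num.floor (s / T).
Definition arc (n : int) (s : R) := spiral k F (zodd n) 1 (b * (s - n%:~R * T)).
Definition periodic_curve (s : R) := arc (cell s) s.
Definition square_wave (s : R) : R := ctrl um up (- (-1) ^+ zodd (cell s)).

Lemma half_period_gt0 : 0 < T. Proof. by rewrite divr_gt0 ?pi_gt0. Qed.

Lemma cell_bounds s : (cell s)%:~R * T <= s /\ s < ((cell s)%:~R + 1) * T.
Proof.
have := floor_itv (s / T); rewrite -/(cell s) intrD => /andP[s1 s2].
by rewrite -ler_pdivlMr ?half_period_gt0// -ltr_pdivrMr ?half_period_gt0.
Qed.

Lemma cellE n s : n%:~R * T <= s -> s < (n%:~R + 1) * T -> cell s = n.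
Proof.
move=> s1 s2; apply: floor_def; rewrite intrD.
by rewrite ler_pdivlMr ?half_period_gt0// ltr_pdivrMr ?half_period_gt0// s1.
Qed.

Lemma spiral_junction e : spiral k F e 1 pi = spiral k F (~~ e) 1 0.
Proof.
rewrite /spiral sypi sy0 sx0 sxpi// spiral_scaleE// signrN; congr pt; ring.
Qed.

Lemma arc_junction n : arc (n - 1) (n%:~R * T) = arc n (n%:~R * T).
Proof.
rewrite /arc subrr mulr0 zodd_pred -[in RHS](negbK (zodd n)) -spiral_junction.
by congr spiral; rewrite intrB /T; field; rewrite gt_eqF.
Qed.

Lemma arc_derive n (s : R) :
  is_derive s 1 (arc n) (A *m arc n s + ctrl um up (- (-1) ^+ zodd n) *: eta).
Proof.
have [_ _ /(_ s)] := trajectory_spiral (zodd n) 1 (- (b * (n%:~R * T))).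
have -> : (fun s => spiral (- a / b) F (zodd n) 1 (- (b * (n%:~R * T)) + b * s)) =
  arc n.
  by apply/funext => z; rewrite /arc; congr spiral; ring.
have -> : spiral (- a / b) F (zodd n) 1 (- (b * (n%:~R * T)) + b * s) = arc n s.
  by rewrite /arc; congr spiral; ring.
by apply; exact: cst_continuous.
Qed.

Lemma arc_continuous n : continuous (arc n).
Proof.
move=> s; apply/differentiable_continuous/derivable1_diffP.
by case: (arc_derive n s).
Qed.

Lemma near_cell (s : R) : s != (cell s)%:~R * T -> \forall z \near s, cell s = cell z.
Proof.
have [s1 s2] := cell_bounds s; move=> sn.
have {}s1 : (cell s)%:~R * T < s by rewrite lt_neqAle eq_sym sn.
near=> z; apply/esym/cellE.
  by apply/ltW; near: z; exact: lt_nbhsr.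
by near: z; exact: lt_nbhsl.
Unshelve. all: by end_near. Qed.

Lemma near_cellW (s : R) : \forall z \near s,
  cell z = cell s \/ (z <= s /\ cell z = cell s - 1).
Proof.
have [s1 s2] := cell_bounds s; have T0 := half_period_gt0.
near=> z; have [sz|zs] := leP ((cell s)%:~R * T) z.
  by left; apply: cellE => //; near: z; exact: lt_nbhsl.
right; split; first by lra.
apply: cellE; rewrite intrB.
  apply/ltW; near: z; apply: lt_nbhsr; nra.
by rewrite subrK.
Unshelve. all: by end_near. Qed.

(** The jump has height [up - um]. It exempts [trajectory] from a derivative at the junctions, where
    the velocity changes, and bars an interval free of discontinuities from meeting two cells. *)
Lemma square_wave_jump (s : R) : s = (cell s)%:~R * T ->
  ~ {for s, continuous square_wave}.
Proof.
move=> sE cs; have T0 := half_period_gt0.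
have [z [[wz zs] zT]] : exists z : R,
    (`|square_wave s - square_wave z| < up - um /\ z < s) /\ s - T < z.
  apply: (@filter_ex _ s^'-); apply: filterI; first apply: filterI.
  - have : \forall z \near s, `|square_wave s - square_wave z| < up - um.
      by move/cvgrPdist_lt : cs; apply; rewrite subr_gt0.
    exact: (@cvg_within _ (nbhs s)).
  - exact: nbhs_left_lt.
  - by apply: nbhs_left_gt; lra.
have cz : cell z = cell s - 1.
  by apply: cellE; rewrite intrB ?subrK -?sE//; rewrite mulrBl -sE; lra.
move: wz; rewrite /square_wave cz zodd_pred signrN /ctrl.
have -> : forall y : R, (up + um) / 2 - (up - um) / 2 * - y -
    ((up + um) / 2 - (up - um) / 2 * - - y) = (up - um) * y by move=> y; field.
by rewrite normrM normr_sign mulr1 gtr0_norm ?subr_gt0// ltxx.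
Qed.

Lemma controls_square_wave : controls um up square_wave.
Proof.
have T0 := half_period_gt0.
have disc s : discontinuities square_wave s -> s = (cell s)%:~R * T.
  move=> ds; apply/eqP; apply: contrapT => /negP sn; apply: ds.
  apply: (@near_eq_continuous_at _ _ _ (cst (square_wave s)));
    last exact: cst_continuous.
  by apply: filterS (near_cell _ sn) => z zE; rewrite /square_wave zE.
split; last first.
  by move=> s; apply: ctrl_bound => //; case: (zodd _); rewrite ?expr0 ?expr1;
    apply/andP; split; lra.
split=> c d.
  pose N := `|cell d - cell c|%N.+1.
  have : finite_set ((fun i : nat => (cell c + i%:Z)%:~R * T) @` `I_N).
    exact/finite_image/finite_II.
  apply: sub_finite_set => s [/=]; rewrite in_itv/= => /andP[cs sd] /disc sE.
  have h1 : (cell c <= cell s)%R by apply: le_floor; rewrite ler_pM2r ?invr_gt0.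
  have h2 : (cell s <= cell d)%R by apply: le_floor; rewrite ler_pM2r ?invr_gt0.
  exists `|cell s - cell c|%N; first by rewrite /= /N; lia.
  by rewrite [RHS]sE; congr (_%:~R * _); lia.
move=> cd H.
have h : (cell c <= cell d)%R by apply: le_floor; rewrite ler_pM2r ?invr_gt0.
move: h; rewrite le_eqVlt => /orP[/eqP E|h]; first by rewrite /square_wave E.
exfalso; have [d1 d2] := cell_bounds d; have [c1 c2] := cell_bounds c.
have dE : cell ((cell d)%:~R * T) = cell d.
  by apply: cellE => //; rewrite ltr_pM2r//; lra.
(* When [c] and [d] lie in different cells, the left end of the cell of [d] is a jump between
   them. *)
apply: (H ((cell d)%:~R * T)); last by apply: square_wave_jump; rewrite dE.
rewrite /= in_itv/= d1 andbT (le_trans (ltW c2))// ler_pM2r//.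
by rewrite -[1]/(1%:~R) -intrD ler_int; lia.
Qed.

Lemma trajectory_periodic : trajectory A eta (periodic_curve 0) square_wave
    periodic_curve.
Proof.
split=> //.
  move=> s; rewrite /continuous_at; apply/cvgrPdist_lt => e e0.
  have /cvgrPdist_lt/(_ _ e0) H1 := arc_continuous (cell s) s.
  have [sE|sn] := eqVneq s ((cell s)%:~R * T); last first.
    apply: filterS2 H1 (near_cell _ sn) => z Hz zE.
    by rewrite /periodic_curve -zE.
  have /cvgrPdist_lt/(_ _ e0) H2 := arc_continuous (cell s - 1) s.
  apply: filterS3 H1 H2 (near_cellW s) => z Hz1 Hz2 zE.
  rewrite /periodic_curve; case: zE => [->//|[_ ->]].
  by have := arc_junction (cell s); rewrite -sE => <-.
move=> s cs; have sn : s != (cell s)%:~R * T by apply/eqP => /square_wave_jump.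
have := arc_derive (cell s) s; apply: near_eq_is_derive => //.
by apply: filterS (near_cell _ sn) => z zE; rewrite /periodic_curve zE.
Qed.

Lemma curve_periodic (s : R) : curve k F (periodic_curve s).
Proof.
have [s1 s2] := cell_bounds s.
exists (zodd (cell s)), 1, (b * (s - (cell s)%:~R * T)); split=> //.
have -> : pi = b * T by rewrite /T; field; rewrite gt_eqF.
by rewrite mulr_ge0 ?(ltW b0) ?subr_ge0// ler_pM2l//; lra.
Qed.

(** The point is wanted at arbitrarily early times because the reversed system runs the curve
    backwards. Angle [pi] is first rewritten as angle 0 of the other half, the cells being half
    open. *)
Lemma periodic_curve_surj v (s : R) : curve k F v ->
    exists2 s', s' <= s & periodic_curve s' = v.
Proof.
have T0 := half_period_gt0.
move=> [e0 [t [th0 [/= -> _ /andP[th00 th0pi] ->]]]].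
have [e [th [hth0 hthpi ->]]] : exists e th, [/\ 0 <= th, th < pi &
    spiral k F e0 1 th0 = spiral k F e 1 th].
  have [->|n] := eqVneq th0 pi.
    by exists (~~ e0), 0; rewrite spiral_junction pi_gt0.
  by exists e0, th0; split=> //; rewrite lt_neqAle n.
(* Going back [2 * N] half periods keeps the parity of the arc and brings the time below [s]. *)
have [N HN] : exists N : nat, (T + th / b - s) / (2 * T) < N%:R.
  pose y := (T + th / b - s) / (2 * T); exists (absz (Num.floor y + 1)).
  by rewrite (lt_le_trans (floorD1_gt y))// natr_absz ler_int ler_norm.
pose n : int := (e : nat)%:Z - 2 * N%:Z.
pose s' := n%:~R * T + th / b.
have cs' : cell s' = n.
  apply: cellE; first by rewrite /s' lerDl divr_ge0 ?(ltW b0).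
  by rewrite /s' mulrDl ltrD2l mul1r /T ltr_pM2r ?invr_gt0.
exists s'.
  have eb : (e : nat)%:R <= 1 :> R by case: (e) => //=; exact: ler01.
  have -> : s' = (e : nat)%:R * T - N%:R * (2 * T) + th / b.
    rewrite /s' /n intrB intrM; congr (_ + _); ring.
  by move: HN; rewrite ltr_pdivrMr; [nra|lra].
rewrite /periodic_curve cs' /arc; congr spiral.
  exact: zodd_shift.
by rewrite /s'; field; rewrite gt_eqF.
Qed.

End Periodic.

(** * Recurrence and exponential contraction *)

Local Notation sqdist v w := ((cx F v - cx F w) ^+ 2 + (cy F v - cy F w) ^+ 2).

(** The flow contracts the Euclidean distance of the frame, not the sup norm; this lemma and
    [near_sqdist] pass between the two topologies. *)
Lemma nbhs_coords (v : 'cV[R]_2) B : nbhs v B ->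
  exists2 e : R, 0 < e & forall w, sqdist w v < e -> B w.
Proof.
move=> Bv.
have : nbhs (cx F v, cy F v) ((fun p : R * R => pt F p.1 p.2) @^-1` B).
  apply: (@pt_continuous _ _ F fst snd (cx F v, cy F v));
    [exact: cvg_fst|exact: cvg_snd|].
  by rewrite ptK.
move=> [[P Q] /= [[d1 /= d10 H1] [d2 /= d20 H2]] PQ].
exists (Num.min d1 d2 ^+ 2); first by rewrite exprn_gt0// lt_min d10.
move=> w wv; rewrite -(ptK F w); apply: (PQ (cx F w, cy F w)).
have m0 : 0 < Num.min d1 d2 by rewrite lt_min d10.
have small (p q : R) : p ^+ 2 + q ^+ 2 < Num.min d1 d2 ^+ 2 -> `|p| < d1 /\ `|q| < d2.
  move=> H; split.
    have : `|p| < Num.min d1 d2.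
      rewrite -ltr_sqr ?nnegrE ?(ltW m0)// real_normK ?num_real//.
      by apply: le_lt_trans H; rewrite lerDl sqr_ge0.
    by rewrite lt_min => /andP[].
  have : `|q| < Num.min d1 d2.
    rewrite -ltr_sqr ?nnegrE ?(ltW m0)// real_normK ?num_real//.
    by apply: le_lt_trans H; rewrite lerDr sqr_ge0.
  by rewrite lt_min => /andP[].
have [h1 h2] := small _ _ wv.
by split; [apply: H1|apply: H2] => /=; rewrite distrC.
Qed.

Lemma near_sqdist (v : 'cV[R]_2) (e : R) : 0 < e -> \forall w \near v, sqdist w v < e.
Proof.
move=> e0; pose d := Num.min 1 (e / 2).
have d0 : 0 < d by rewrite lt_min ltr01 divr_gt0.
have dd : d ^+ 2 <= e / 2.
  have [d1 d2] : d <= 1 /\ d <= e / 2 by rewrite !ge_min !lexx orbT.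
  by rewrite expr2; nra.
have /cvgrPdist_lt/(_ _ d0) Hx := cx_continuous F v.
have /cvgrPdist_lt/(_ _ d0) Hy := cy_continuous F v.
have sq (x : R) : `|x| < d -> x ^+ 2 < d ^+ 2.
  by move=> xd; rewrite -real_normK ?num_real// ltr_sqr ?nnegrE ?(ltW d0).
near=> w.
have hx : `|cx F w - cx F v| < d by rewrite distrC; near: w.
have hy : `|cy F w - cy F v| < d by rewrite distrC; near: w.
by have := sq _ hx; have := sq _ hy; lra.
Unshelve. all: by end_near. Qed.

Lemma continuous_coord_lin (al be c d : R) (w : 'cV[R]_2) :
  {for w, continuous (fun w => al * (cx F w - c) + be * (cy F w - d))}.
Proof.
have Hx : {for w, continuous (fun w => cx F w - c)}.
  by apply: continuousB; [exact: cx_continuous|exact: cst_continuous].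
have Hy : {for w, continuous (fun w => cy F w - d)}.
  by apply: continuousB; [exact: cy_continuous|exact: cst_continuous].
by apply: continuousD; apply: continuousM;
  first [exact: cst_continuous|exact: Hx|exact: Hy].
Qed.

Lemma exp_decay (M e : R) : 0 <= M -> 0 < e ->
  exists2 s, 0 <= s & expR (a * s) ^+ 2 * M < e.
Proof.
move=> M0 e0; have na : 0 < - a by rewrite oppr_gt0.
(* At this time the exponential is [exp (- M / e)], at most [1 / (1 + M / e)], and this times [M] is
   below [e]. *)
exists (M / e / - a); first by rewrite !divr_ge0// ltW.
have h0 : 0 <= M / e by rewrite divr_ge0// ltW.
set E := expR _.
have E0 : 0 < E by exact: expR_gt0.
have E1 : E * (1 + M / e) <= 1.
  have := expR_ge1Dx (M / e); have -> : expR (M / e) = E^-1.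
    by rewrite /E -expRN; congr expR; field; rewrite (gt_eqF e0) (lt_eqF a0).
  by move=> H; rewrite -ler_pdivlMl// mulr1.
have EM : E * (e + M) <= e.
  have -> : E * (e + M) = E * (1 + M / e) * e by field; rewrite gt_eqF.
  by rewrite ler_piMl// ltW.
have E2 : E <= 1 by nra.
have : 0 < E * e by rewrite mulr_gt0.
have : E * E * M <= E * M by rewrite -mulrA ler_piMl// mulr_ge0// ltW.
rewrite expr2; nra.
Qed.

Lemma orbit_contraction v w z : positive_orbit A eta um up v w -> hull k F z ->
  exists2 z', hull k F z' & sqdist w z' <= sqdist v z.
Proof.
move=> [u [x [s [cu tx s0 ->]]]] hz.
have [z' hz' E] := hull_contraction _ _ _ _ _ cu tx hz s0.
exists z' => //; rewrite E ler_piMl ?addr_ge0 ?sqr_ge0//.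
by rewrite exprn_ile1 ?expR_ge0// expR_le1 mulr_le0_ge0// ltW.
Qed.

Lemma cx_org : cx F (org F) = 0.
Proof. by rewrite -[org F](_ : pt F 0 0 = _) ?ptK1// /pt !scale0r !addr0. Qed.

Lemma cy_org : cy F (org F) = 0.
Proof. by rewrite -[org F](_ : pt F 0 0 = _) ?ptK2// /pt !scale0r !addr0. Qed.

Lemma inside_org : inside k F (org F).
Proof.
have r0 := spiral_scale_gt0 k k0; have h0 : 0 <= (0 : R) <= pi by rewrite lexx pi_ge0.
have v1 := vertex_gt1 k k0.
exists false, (spiral_scale k)^-1, 0; split=> //.
- by rewrite /= invf_lt1// spiral_scaleE//; lra.
- by rewrite invr_ge0 ltW.
- by rewrite /spiral sx0 sy0 mulVf ?gt_eqF// addNr !mulr0 /pt !scale0r !addr0.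
Qed.

Lemma hull_org : hull k F (org F).
Proof. by rewrite hullE; left; exact: inside_org. Qed.

Lemma sqdist_tri (v w z : 'cV[R]_2) (e : R) : sqdist v w < e / 4 ->
    sqdist w z < e / 4 -> sqdist z v < e.
Proof.
set p := cx F v; set q := cx F w; set r := cx F z.
set p' := cy F v; set q' := cy F w; set r' := cy F z.
have H (x y : R) : (x + y) ^+ 2 <= 2 * x ^+ 2 + 2 * y ^+ 2.
  by have := sqr_ge0 (x - y); rewrite !expr2; lra.
have := H (r - q) (q - p); have := H (r' - q') (q' - p').
rewrite !subrKA => h1 h2 h3 h4.
rewrite -(sqrrN (q - p)) -(sqrrN (q' - p')) -(sqrrN (r - q)) -(sqrrN (r' - q'))
  !opprB in h1 h2.
lra.
Qed.

(** A point of a pre-control set is recurrent after arbitrarily long times,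
    whereas the distance to [hull] decays exponentially. *)
Lemma pre_control_set_hull D : pre_control_set A eta um up D -> D `<=` hull k F.
Proof.
move=> [Da Db] v Dv; suff : closure (hull k F) v by exact: closed_hull.
move=> B /nbhs_coords[e e0 eB].
have [u [x [cu tx Dx]]] := Da _ Dv.
have e4 : 0 < e / 4 by lra.
have [T T0 TM] := exp_decay (sqdist v (org F)) _ (addr_ge0 (sqr_ge0 _) (sqr_ge0 _)) e4.
have [y [oy yv]] := Db _ (Dx _ T0) _ Dv _ (near_sqdist v _ e4).
have [z1 hz1 E] := hull_contraction _ _ _ _ _ cu tx hull_org T0.
have [z2 hz2 z2y] := orbit_contraction _ _ _ oy hz1.
exists z2; split=> //; apply: eB; apply: (sqdist_tri v y).
  by move: yv; rewrite -(sqrrN (cx F y - _)) -(sqrrN (cy F y - _)) !opprB.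
by apply: le_lt_trans z2y _; rewrite E.
Qed.

(** Read in stable time, a point [y] near [v] is steered to [x T], which does not increase the
    distance to a suitable point of [hull], and then to [v] during the time [T], which contracts
    it. *)
Lemma pre_control_set_hullN D : pre_control_set (- A) (- eta) um up D ->
    D `<=` hull k F.
Proof.
move=> [Da Db] v Dv; suff : closure (hull k F) v by exact: closed_hull.
move=> B /nbhs_coords[e e0 eB].
have [u [x [cu tx Dx]]] := Da _ Dv.
(* [y] is chosen after [T], so [M] must bound its squared distance to [org F] for every [y] at
   distance less than 1 from [v]. *)
pose M := 2 * (1 + sqdist v (org F)).
have M0 : 0 <= M by rewrite mulr_ge0// !addr_ge0 ?sqr_ge0.
have [T T0 TM] := exp_decay M _ M0 e0.
have [y [oy yv]] := Db _ (Dx _ T0) _ Dv _ (near_sqdist v _ ltr01).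
have := positive_orbit_rev oy; rewrite !opprK => oy'.
have := trajectory_compN T tx; rewrite !opprK => tx'.
have cu' := controls_compN T cu.
have [z1 hz1 z1x] := orbit_contraction _ _ _ oy' hull_org.
have [z2 hz2 E] := hull_contraction _ _ _ _ _ cu' tx' hz1 T0.
have x0v : x (T - T) = v by rewrite subrr; case: tx.
rewrite x0v in E; exists z2; split=> //; apply: eB.
rewrite -(sqrrN (cx F z2 - _)) -(sqrrN (cy F z2 - _)) !opprB E.
apply: le_lt_trans TM; rewrite ler_wpM2l ?sqr_ge0//.
apply: le_trans z1x _; rewrite /M cx_org cy_org !subr0.
have H (p q : R) : p ^+ 2 <= 2 * (p - q) ^+ 2 + 2 * q ^+ 2.
  by have := sqr_ge0 (p - 2 * q); rewrite !expr2; lra.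
have := H (cx F y) (cx F v); have := H (cy F y) (cy F v); move: yv; lra.
Qed.

(** The flow of a fixed control is open, so that it preserves the interior of
    [hull]. *)
Lemma inside_invariant (v : 'cV[R]_2) u x (s : R) : controls um up u ->
    trajectory A eta v u x ->
  inside k F v -> 0 <= s -> inside k F (x s).
Proof.
move=> cu tx iv s0; rewrite -interior_hull//.
(* [(p w, q w)] is the displacement [w - x s] transported back to time 0: from [g w] below, the same
   control leads to [w]. *)
pose p w := rotx a b (- s) (cx F w - cx F (x s)) (cy F w - cy F (x s)).
pose q w := roty a b (- s) (cx F w - cx F (x s)) (cy F w - cy F (x s)).
have cp (w : 'cV[R]_2) : {for w, continuous p}.
  rewrite (_ : p = fun w => (expR (a * - s) * cos (b * - s)) * (cx F w - cx F (x s)) +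
      (- (expR (a * - s) * sin (b * - s))) * (cy F w - cy F (x s))).
    exact: continuous_coord_lin.
  by apply/funext => z; rewrite /p /rotx; ring.
have cq (w : 'cV[R]_2) : {for w, continuous q}.
  rewrite (_ : q = fun w => (expR (a * - s) * sin (b * - s)) * (cx F w - cx F (x s)) +
      (expR (a * - s) * cos (b * - s)) * (cy F w - cy F (x s))).
    exact: continuous_coord_lin.
  by apply/funext => z; rewrite /q /roty; ring.
pose g w := pt F (cx F v + p w) (cy F v + q w).
have cg : {for x s, continuous g}.
  apply: pt_continuous; apply: continuousD; try exact: cst_continuous;
    [exact: cp|exact: cq].
have gx : g (x s) = v.
  by rewrite /g /p /q !subrr /rotx /roty !mulr0 subr0 addr0 mulr0 !addr0 ptK.
have : \forall w \near x s, inside k F (g w).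
  apply: cg; rewrite gx; apply: open_nbhs_nbhs; split=> //; exact: open_inside.
rewrite /interior /=; apply: filterS => w iw.
have tw := trajectory_translate FA _ _ _ (p w) (q w) tx.
have hw : hull k F (g w) by rewrite hullE; left.
have := hull_invariant _ _ _ _ cu tw hw s0.
have E : expR (a * s) * expR (a * - s) = 1 by rewrite -expRD mulrN subrr expR0.
have C := cos2Dsin2 (b * s).
have rE (y z : R) : rotx a b s (rotx a b (- s) y z) (roty a b (- s) y z) = y.
  transitivity (expR (a * s) * expR (a * - s) * ((cos (b * s) ^+ 2 +
    sin (b * s) ^+ 2) * y)).
    by rewrite /rotx /roty (mulrN b) cosN sinN; ring.
  by rewrite E C !mul1r.
have rE' (y z : R) : roty a b s (rotx a b (- s) y z) (roty a b (- s) y z) = z.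
  transitivity (expR (a * s) * expR (a * - s) * ((cos (b * s) ^+ 2 +
    sin (b * s) ^+ 2) * z)).
    by rewrite /rotx /roty (mulrN b) cosN sinN; ring.
  by rewrite E C !mul1r.
by rewrite /p /q rE rE' !subrKC ptK.
Qed.

(** * The control sets of both systems *)

Lemma pre_control_set_stable : pre_control_set A eta um up (hull k F).
Proof.
have wb : (-1 : R) <= (0 : R) <= (1 : R) by apply/andP; split; lra.
split=> v hv.
  have tx := trajectory_rot FA (cx F v) (cy F v) 0.
  rewrite ptK in tx; have cu := controls_cst _ _ _ umup wb.
  do 2 eexists; split; [exact: cu|exact: tx|] => s s0.
  exact: (hull_invariant _ _ _ _ cu tx hv s0).
(* Interior points are reached exactly, through [org F]; points of the orbit only as limits of
   these. *)
rewrite -closure_inside//; apply: closure_subset => w iw.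
apply: (positive_orbit_trans (org F)) => //.
  exact: (reach_org).
exact: (reach_from_org).
Qed.

Lemma control_set_stable D : control_set A eta um up D <-> D = hull k F.
Proof.
split=> [[pD Dmax]|->].
  by rewrite (Dmax _ pre_control_set_stable)//; exact: pre_control_set_hull.
split=> [|D' pD' hD']; first exact: pre_control_set_stable.
by apply/seteqP; split=> //; exact: pre_control_set_hull.
Qed.

Lemma adaptedN : adapted F (- A) (- eta) um up (- a) (- b).
Proof.
have [H1 H2 H3 H4] := FA.
split; rewrite mulNmx.
- by rewrite H1 scalerN.
- by rewrite H2 scalerN.
- by rewrite H3 opprD !scaleNr.
- by rewrite H4 opprD !scaleNr.
Qed.

Lemma inside_backward v w : positive_orbit (- A) (- eta) um up v w ->
    inside k F w -> inside k F v.
Proof.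
move=> /positive_orbit_rev; rewrite !opprK => -[u [x [s [cu tx s0 ->]]]] iw.
exact: (inside_invariant _ _ _ _ cu tx).
Qed.

(** In the unstable system a fixed control may drive the point out. For clause (a) it is therefore
    steered to [org F], where the control [w = 0] keeps it at rest. *)
Lemma pre_control_set_inside : pre_control_set (- A) (- eta) um up (inside k F).
Proof.
have wb : (-1 : R) <= (0 : R) <= (1 : R) by apply/andP; split; lra.
have to_org v : inside k F v -> positive_orbit (- A) (- eta) um up v (org F).
  move=> iv; apply: positive_orbit_rev.
  exact: (reach_from_org).
split=> v iv.
  have [u [x [T [cu tx T0 xT]]]] := to_org _ iv.
  have t0 := trajectory_rot adaptedN 0 0 0.
  have o0 : pt F 0 0 = org F by rewrite /pt !scale0r !addr0.
  rewrite o0 xT in t0; have c0 := controls_cst _ _ _ umup wb.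
  have [u' cu' tx'] := trajectory_concat umup T0 cu tx c0 t0.
  do 2 eexists; split; [exact: cu'|exact: tx'|] => s s0 /=.
  have [sT|Ts] := ltP s T; last first.
    have -> : pt F (0 + rotx (- a) (- b) (s - T) (0 - 0) 0) (roty (- a) (- b) (s -
      T) (0 - 0) 0) = org F.
      by rewrite -o0 /rotx /roty; congr pt; ring.
    exact: inside_org.
  (* Before [T], the path read backwards is a stable trajectory issued from [org F], hence stays
     inside. *)
  have := trajectory_compN T tx; rewrite !opprK -xT => tr.
  have Ts : 0 <= T - s by rewrite subr_ge0 ltW.
  have := inside_invariant _ _ _ _ (controls_compN T cu) tr inside_org Ts.
  by rewrite subKr.
move=> w iw; apply: subset_closure.
apply: (positive_orbit_trans (org F)) => //; first exact: to_org.
by apply: positive_orbit_rev; exact: (reach_org).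
Qed.

Lemma pre_control_set_curve : pre_control_set (- A) (- eta) um up (curve k F).
Proof.
have tp := trajectory_periodic.
have cp := controls_square_wave.
split=> v cv.
  have [s _ sv] := periodic_curve_surj _ 0 cv.
  have := trajectory_compN s tp; rewrite sv => tx.
  do 2 eexists; split; [exact: (controls_compN s cp)|exact: tx|] => z _ /=.
  exact: curve_periodic.
move=> w cw; apply: subset_closure.
have [s _ sv] := periodic_curve_surj _ 0 cv.
have [s' s's sw] := periodic_curve_surj _ s cw.
have := trajectory_compN s tp; rewrite sv => tx.
do 2 eexists; exists (s - s'); split; [exact: (controls_compN s cp)|exact: tx| |].
  by rewrite subr_ge0.
by rewrite /= subKr.
Qed.

(** If [D] met both sets, the orbit of a point of the curve would enter the open set [inside], and
    backward invariance would put that point inside. *)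
Lemma pre_control_set_unstable D : pre_control_set (- A) (- eta) um up D ->
  D `<=` inside k F \/ D `<=` curve k F.
Proof.
move=> pD; have Dh := pre_control_set_hullN _ pD.
have [[v [Dv cv]]|nD] := pselect (exists v, D v /\ curve k F v); last first.
  left=> v Dv; have := Dh _ Dv; rewrite hullE => -[//|cv].
  by exfalso; apply: nD; exists v.
right=> w Dw; have := Dh _ Dw; rewrite hullE => -[iw|//]; exfalso.
have [_ /(_ _ Dv _ Dw) wcl] := pD.
have [y [oy iy]] := wcl _ (open_nbhs_nbhs (conj (open_inside k k0 F) iw)).
by apply: (insideNcurve k k0 F v) => //; exact: inside_backward iy.
Qed.

Lemma control_set_unstable D : control_set (- A) (- eta) um up D <->
  D = inside k F \/ D = curve k F.
Proof.
split=> [[pD Dmax]|].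
  have [Di|Dc] := pre_control_set_unstable _ pD; [left|right].
    by rewrite (Dmax _ pre_control_set_inside).
  by rewrite (Dmax _ pre_control_set_curve).
have cpt : curve k F (spiral k F false 1 0).
  by exists false, 1, 0; rewrite lexx pi_ge0.
case=> ->; split; [exact: pre_control_set_inside| |exact: pre_control_set_curve|].
  move=> D' pD' iD'; apply/seteqP; split=> //.
  have [//|D'c] := pre_control_set_unstable _ pD'.
  by have := insideNcurve k k0 F _ inside_org (D'c _ (iD' _ inside_org)).
move=> D' pD' cD'; apply/seteqP; split=> //.
have [D'i|//] := pre_control_set_unstable _ pD'.
by have := insideNcurve k k0 F _ (D'i _ (cD' _ cpt)) cpt.
Qed.

(** * The curve as the periodic orbit of the statement *)

Section Orbit.
Variable q : 'cV[R]_2.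
Hypotheses (orgE : org F = - ((up + um) / 2) *: q) (exE : ex F = ((up - um) / 2) *: q).

Definition half_curve e : set 'cV[R]_2 :=
  [set v | exists2 th, 0 <= th <= pi & v = spiral k F e 1 th].

Lemma curveE : curve k F = half_curve true `|` half_curve false.
Proof.
apply/seteqP; split=> [v [[] [t [th [/= -> _ hth ->]]]]|v [[th hth ->]|[th hth ->]]].
- by left; exists th.
- by right; exists th.
- by exists true, 1, th.
- by exists false, 1, th.
Qed.

Lemma half_curve_forward e :
  constant_control_arc A eta (spiral k F e 1 0) (ctrl um up (- (-1) ^+ e)) (pi / b)
    = half_curve e.
Proof.
have tx := trajectory_spiral e 1 0.
apply/seteqP; split=> [v [x [s [tx' /andP[s0 sT] ->]]]|v [th /andP[th0 thpi] ->]].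
  rewrite (trajectory_cst_unique FA _ _ _ _ tx' tx).
  exists (0 + b * s) => //; rewrite add0r mulr_ge0 ?(ltW b0)//=.
  by rewrite mulrC -ler_pdivlMr.
eexists; exists (th / b); split; [exact: tx| |].
  by rewrite divr_ge0 ?(ltW b0)//= ler_pM2r ?invr_gt0.
by congr spiral; field; rewrite gt_eqF.
Qed.

Lemma half_curve_backward e :
  constant_control_arc (- A) (- eta) (spiral k F e 1 pi) (ctrl um up (- (-1) ^+ e))
    (pi / b) =
  half_curve e.
Proof.
have := trajectory_compN (pi / b) (trajectory_spiral e 1 0).
have -> : 0 + b * (pi / b) = pi by field; rewrite gt_eqF.
move=> tx; have FN := adaptedN.
apply/seteqP; split=> [v [x [s [tx' /andP[s0 sT] ->]]]|v [th /andP[th0 thpi] ->]].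
  rewrite (trajectory_cst_unique FN _ _ _ _ tx' tx).
  exists (0 + b * (pi / b - s)) => //; rewrite add0r mulr_ge0 ?(ltW b0) ?subr_ge0//=.
  by rewrite mulrC -ler_pdivlMr// lerBlDr lerDl.
eexists; exists ((pi - th) / b); split; [exact: tx| |].
  by rewrite divr_ge0 ?(ltW b0) ?subr_ge0//= ler_pM2r ?invr_gt0// lerBlDr lerDl.
by congr spiral; field; rewrite gt_eqF.
Qed.

Lemma ctrl1 : ctrl um up (- (-1) ^+ true) = um.
Proof. by rewrite /ctrl expr1; field. Qed.

Lemma ctrlN1 : ctrl um up (- (-1) ^+ false) = up.
Proof. by rewrite /ctrl expr0; field. Qed.

Lemma pt_real x : pt F x 0 = (- ((up + um) / 2) + x * ((up - um) / 2)) *: q.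
Proof. by rewrite /pt orgE exE scale0r addr0 scalerA -scalerDl. Qed.

Lemma periodic_orbit_forward : q = invmx A *m eta ->
    periodic_orbit A eta um up a b = curve k F.
Proof.
move=> qE; have r1 := decay_lt1 k k0.
have rn : 1 - decay k != 0 by rewrite subr_eq0 eq_sym lt_eqF.
have dE : expR (pi * a / b) = decay k.
  by rewrite /decay /k; congr expR; field; rewrite gt_eqF.
rewrite curveE -(half_curve_forward true) -(half_curve_forward false) ctrl1 ctrlN1.
rewrite /periodic_orbit /switch_point -qE dE.
congr (constant_control_arc _ _ _ _ _ `|` constant_control_arc _ _ _ _ _);
  rewrite /spiral sx0 sy0 mulr0 pt_real spiral_scaleE// /vertex ?expr1 ?expr0;
  congr (_ *: _); field; exact: rn.
Qed.

(** The growth factor in the switch points is now the inverse of [decay], which exchanges the two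
    vertices. Accordingly each arc is run from its end at angle [pi]. *)
Lemma periodic_orbit_backward : q = invmx (- A) *m - eta ->
  periodic_orbit (- A) (- eta) um up (- a) b = curve k F.
Proof.
move=> qE; have r1 := decay_lt1 k k0; have r0 := decay_gt0 k.
have rn : 1 - decay k != 0 by rewrite subr_eq0 eq_sym lt_eqF.
have dE : expR (pi * - a / b) = (decay k)^-1.
  by rewrite /decay -expRN /k; congr expR; field; rewrite gt_eqF.
rewrite curveE -(half_curve_backward true) -(half_curve_backward false) ctrl1 ctrlN1.
rewrite /periodic_orbit /switch_point -qE dE.
congr (constant_control_arc _ _ _ _ _ `|` constant_control_arc _ _ _ _ _);
  rewrite /spiral sxpi// sypi mulr0 pt_real /vertex ?expr1 ?expr0;
  congr (_ *: _); field; by rewrite ?rn ?(gt_eqF r0) ?subr_eq0 ?(lt_eqF r1).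
Qed.

End Orbit.
End StableSystem.

Theorem theorem3p8 (R : realType) (A : 'M[R]_2) (eta : 'cV[R]_2)
    (um up lam mu : R)
    (hdisc : (\tr A) ^+ 2 - 4 * \det A < 0)
    (htr : \tr A != 0)
    (heta : eta != 0)
    (hu : um < up)
    (hmu : 0 < mu)
    (heig : eigenvalue (map_mx (real_complex R) A) (lam +i* mu)%C)
    (heigc : eigenvalue (map_mx (real_complex R) A) (lam -i* mu)%C) :
  let C := closure (delimited_region (periodic_orbit A eta um up lam mu)) in
  let D := if \tr A < 0 then C else interior C in
  (\tr A < 0 ->
     forall D' : set 'cV[R]_2, control_set A eta um up D' <-> D' = D) /\
  (0 < \tr A ->
     forall D' : set 'cV[R]_2,
       control_set A eta um up D' <-> (D' = interior D \/ D' = boundary D)).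
Proof.
have [trE detE] := eigenvalue_tr_det _ _ _ _ (lt0r_neq0 hmu) heig.
have Au : A \in unitmx by rewrite unitmxE unitfE detE gt_eqF// ltr_wpDl ?sqr_ge0
  ?exprn_gt0.
have Aq : A *m (invmx A *m eta) = eta by rewrite mulmxA mulmxV// mul1mx.
rewrite /=; split=> trA D'.
  have a0 : lam < 0 by lra.
  have [F [FA oE xE]] := exists_frame _ _ _ _ _ _ _ _ trE detE hmu Aq heta hu.
  rewrite trA (periodic_orbit_forward FA a0 hmu _ oE xE)//.
  have k0 := rate_gt0 a0 hmu.
  rewrite delimited_curve// closure_inside//.
  exact: control_set_stable.
(* For positive trace the frame is adapted to the stable pair [- A], [- eta], and the given system
   is its time reversal. Both pairs have the same [invmx A *m eta]. *)
have a0 : - lam < 0 by lra.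
have trN : \tr (- A) = 2 * - lam by rewrite raddfN/= trE; ring.
have detN : \det (- A) = (- lam) ^+ 2 + mu ^+ 2.
  by rewrite sqrrN -detE !det2E !mxE; ring.
have AqN : - A *m (invmx A *m eta) = - eta by rewrite mulNmx Aq.
have etaN : - eta != 0 by rewrite oppr_eq0.
have [F [FA oE xE]] := exists_frame _ _ _ _ _ _ _ _ trN detN hmu AqN etaN hu.
have qE : invmx A *m eta = invmx (- - A) *m - - eta by rewrite !opprK.
have := periodic_orbit_backward FA a0 hmu _ oE xE qE; rewrite !opprK => ->.
have k0 := rate_gt0 a0 hmu; rewrite opprK in k0.
rewrite delimited_curve// closure_inside// ltNge (ltW trA)/= interior_hull//.
have -> : interior (inside (lam / mu) F) = inside (lam / mu) F.
  by apply/interior_id; exact: open_inside.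
have -> : boundary (inside (lam / mu) F) = curve (lam / mu) F.
  rewrite /boundary closure_inside// (_ : interior _ = inside (lam / mu) F); last first.
    by apply/interior_id; exact: open_inside.
  rewrite hullE; apply/seteqP; split=> [v [[//|//]]|v cv]; split; first by right.
  by move=> iv; exact: (insideNcurve _ k0 F v).
have := control_set_unstable hu FA a0 hmu D'.
by rewrite !opprK.
Qed.
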